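(* Let $\mathcal{P}\subset\mathbb{R}^6$, its subpolytope $\mathcal{P}_1^1\subset \mathcal{P}$, the six simplices $\Delta_1,\dots,\Delta_6\subset\mathbb{R}^6$, and the standard simplex $\Delta\subset\mathbb{R}^6$ be as defined in the context. Then: 1) $\mathcal{P}_1^1$ is triangulated by $\Delta_1,\dots,\Delta_6$; that is, $\mathcal{P}_1^1=\bigcup_{i=1}^6\Delta_i$, and whenever $\Delta_i\cap\Delta_j\neq\emptyset$, the set $\Delta_i\cap\Delta_j$ is a face of both $\Delta_i$ and $\Delta_j$. 2) $\mathrm{Vol}(\mathcal{P})=\frac{1}{4}\cdot\frac{1}{6!}=\frac14\,\mathrm{Vol}(\Delta)$.
   Context: $\mathrm{Vol}$ denotes 6-dimensional Euclidean volume (Lebesgue measure). Points of $\mathbb{R}^6$ are written in Cartesian coordinates in the order $(x_{12},x_{23},x_{31},x_{13},x_{32},x_{21})$. The polytope $\mathcal{P}\subset\mathbb{R}^6$ is the set of points satisfying $x_{ij}\ge 0$ for all $i\neq j$, $1\le i,j\le 3$, and $$x_{12}+x_{13}+2(x_{21}+x_{31})\le 1,$$ $$x_{21}+x_{23}+2(x_{12}+x_{32})\le 1,$$ $$x_{31}+x_{32}+2(x_{13}+x_{23})\le 1.$$ The standard simplex $\Delta$ is defined by $x_{12}+x_{23}+x_{31}+x_{13}+x_{32}+x_{21}\le 1$ and $x_{ij}\ge 0$ for $i\ne j$, $1\le i,j\le 3$. Let $O$ be the origin, let $F_1=\{x\in\mathcal{P}: x_{12}+x_{13}+2(x_{21}+x_{31})=1\}$,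 and let $\mathcal{P}_1=\mathrm{conv}(\{O\}\cup F_1)$, where $\mathrm{conv}$ denotes convex hull. The hyperplane $\delta=\{x_{12}+x_{23}+x_{31}=x_{13}+x_{32}+x_{21}\}$ cuts $\mathcal{P}_1$ into two parts; $\mathcal{P}_1^1$ is the part containing the point $P_{31}$ below, i.e. $$\mathcal{P}_1^1=\{x\in\mathcal{P}_1: x_{12}+x_{23}+x_{31}\ge x_{13}+x_{32}+x_{21}\}.$$ Define the following points: $P_{31}=(0,0,\frac12,0,0,0)$, $Q_{32}^{31}=(0,0,\frac12,0,\frac12,0)$, $Q_{23}^{21}=(0,\frac12,0,0,0,\frac12)$, $Q_{12}^{13}=(\frac12,0,0,\frac12,0,0)$, $T_{31}^{13}=(0,0,\frac13,\frac13,0,0)$, $T_{21}^{12}=(\frac13,0,0,0,0,\frac13)$, $K_{21}^{31}=(0,0,\frac14,0,0,\frac14)$, $R_1=(\frac13,\frac13,\frac13,0,0,0)$, $V_{12}^{31}=(\frac12,0,\frac14,0,0,0)$, $V_{31}^{23}=(0,\frac14,\frac12,0,0,0)$. The simplices are the convex hulls $\Delta_1=\mathrm{conv}\{O,P_{31},Q_{32}^{31},Q_{23}^{21},T_{31}^{13},T_{21}^{12},K_{21}^{31}\}$, $\Delta_2=\mathrm{conv}\{O,P_{31},Q_{32}^{31},Q_{23}^{21},T_{31}^{13},T_{21}^{12},Q_{12}^{13}\}$, $\Delta_3=\mathrm{conv}\{O,P_{31},Q_{32}^{31},Q_{23}^{21},R_1,T_{21}^{12},Q_{12}^{13}\}$,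 $\Delta_4=\mathrm{conv}\{O,P_{31},Q_{32}^{31},Q_{23}^{21},T_{31}^{13},R_1,Q_{12}^{13}\}$, $\Delta_5=\mathrm{conv}\{O,P_{31},Q_{32}^{31},V_{12}^{31},R_1,T_{21}^{12},Q_{12}^{13}\}$, $\Delta_6=\mathrm{conv}\{O,P_{31},Q_{32}^{31},Q_{23}^{21},T_{31}^{13},R_1,V_{31}^{23}\}$. A triangulation of a polytope is a decomposition of it into finitely many simplices such that any two of them that intersect do so in a common face. *)

(* Defs.v *)
From HB Require Import structures.
From mathcomp Require Import all_boot all_order all_algebra.
From mathcomp Require Import all_classical all_reals all_analysis.

Set Implicit Arguments.
Unset Strict Implicit.
Unset Printing Implicit Defensive.

Import Order.TTheory GRing.Theory Num.Theory.

Local Open Scope classical_set_scope.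
Local Open Scope ring_scope.

Section convex_geometry.
Variables (R : realType) (n : nat).
Implicit Types (A Q F : set 'rV[R]_n).

Definition conv A : set 'rV[R]_n :=
  smallest (@convex_set R 'rV[R]_n) A.

Definition affinely_independent (m : nat) (v : 'I_m -> 'rV[R]_n) : Prop :=
  forall a : 'I_m -> R,
    \sum_i a i = 0 -> \sum_i a i *: v i = 0 -> forall i, a i = 0.

Definition is_simplex A : Prop :=
  exists (m : nat) (v : 'I_m.+1 -> 'rV[R]_n),
    affinely_independent v /\ A = conv (range v).

(* Faces are cut out by valid linear inequalities; in particular set0 and Q
   are faces of Q (take c = 0). *)
Definition is_face F Q : Prop :=
  exists (c : 'rV[R]_n) (b : R),
    (forall x, Q x -> \sum_i c 0 i * x 0 i <= b) /\
    F = [set x | Q x /\ \sum_i c 0 i * x 0 i = b].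

Definition triangulates (k : nat) (D : 'I_k -> set 'rV[R]_n) Q : Prop :=
  [/\ forall i, is_simplex (D i),
      Q = \bigcup_i D i
    & forall i j, D i `&` D j !=set0 ->
        is_face (D i `&` D j) (D i) /\ is_face (D i `&` D j) (D j)].

End convex_geometry.

Section six_dimensional_volume.
Variable R : realType.

Definition pt6 (a b c d e f : R) : 'rV[R]_6 :=
  \row_(i < 6) nth 0 [:: a; b; c; d; e; f] i.

Local Notation mu := (@lebesgue_measure R).

(* Volume is the 6-fold product of the Lebesgue measure of the line, carried
   over to row vectors.  As with every measure of the library, it is only
   meaningful on measurable sets. *)
Definition Vol (A : set 'rV[R]_6) : \bar R :=
  (mu \x mu \x mu \x mu \x mu \x mu)%E
    [set u | let: (a, b, c, d, e, f) := u in A (pt6 a b c d e f)].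

End six_dimensional_volume.

Section the_polytope.
Variable R : realType.
Implicit Types x : 'rV[R]_6.

(* The coordinates are ordered x12, x23, x31, x13, x32, x21. *)
Definition x12 x : R := x 0 (@Ordinal 6 0 isT).
Definition x23 x : R := x 0 (@Ordinal 6 1 isT).
Definition x31 x : R := x 0 (@Ordinal 6 2 isT).
Definition x13 x : R := x 0 (@Ordinal 6 3 isT).
Definition x32 x : R := x 0 (@Ordinal 6 4 isT).
Definition x21 x : R := x 0 (@Ordinal 6 5 isT).

Definition polytopeP : set 'rV[R]_6 :=
  [set x : 'rV[R]_6 | [/\ forall k, 0 <= x 0 k,
                      x12 x + x13 x + 2 * (x21 x + x31 x) <= 1,
                      x21 x + x23 x + 2 * (x12 x + x32 x) <= 1
                    & x31 x + x32 x + 2 * (x13 x + x23 x) <= 1]].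

Definition std_simplex : set 'rV[R]_6 :=
  [set x : 'rV[R]_6 | (forall k, 0 <= x 0 k) /\
           x12 x + x23 x + x31 x + x13 x + x32 x + x21 x <= 1].

Definition facetF1 : set 'rV[R]_6 :=
  [set x : 'rV[R]_6 | polytopeP x /\ x12 x + x13 x + 2 * (x21 x + x31 x) = 1].

Definition polytopeP1 : set 'rV[R]_6 := conv ([set 0] `|` facetF1).

Definition polytopeP11 : set 'rV[R]_6 :=
  [set x : 'rV[R]_6 | polytopeP1 x /\
     x13 x + x32 x + x21 x <= x12 x + x23 x + x31 x].

Definition P_31 : 'rV[R]_6 := pt6 0 0 (1 / 2) 0 0 0.
Definition Q_32_31 : 'rV[R]_6 := pt6 0 0 (1 / 2) 0 (1 / 2) 0.
Definition Q_23_21 : 'rV[R]_6 := pt6 0 (1 / 2) 0 0 0 (1 / 2).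
Definition Q_12_13 : 'rV[R]_6 := pt6 (1 / 2) 0 0 (1 / 2) 0 0.
Definition T_31_13 : 'rV[R]_6 := pt6 0 0 (1 / 3) (1 / 3) 0 0.
Definition T_21_12 : 'rV[R]_6 := pt6 (1 / 3) 0 0 0 0 (1 / 3).
Definition K_21_31 : 'rV[R]_6 := pt6 0 0 (1 / 4) 0 0 (1 / 4).
Definition R_1 : 'rV[R]_6 := pt6 (1 / 3) (1 / 3) (1 / 3) 0 0 0.
Definition V_12_31 : 'rV[R]_6 := pt6 (1 / 2) 0 (1 / 4) 0 0 0.
Definition V_31_23 : 'rV[R]_6 := pt6 0 (1 / 4) (1 / 2) 0 0 0.

Definition Delta1 : set 'rV[R]_6 :=
  conv [set 0; P_31; Q_32_31; Q_23_21; T_31_13; T_21_12; K_21_31].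
Definition Delta2 : set 'rV[R]_6 :=
  conv [set 0; P_31; Q_32_31; Q_23_21; T_31_13; T_21_12; Q_12_13].
Definition Delta3 : set 'rV[R]_6 :=
  conv [set 0; P_31; Q_32_31; Q_23_21; R_1; T_21_12; Q_12_13].
Definition Delta4 : set 'rV[R]_6 :=
  conv [set 0; P_31; Q_32_31; Q_23_21; T_31_13; R_1; Q_12_13].
Definition Delta5 : set 'rV[R]_6 :=
  conv [set 0; P_31; Q_32_31; V_12_31; R_1; T_21_12; Q_12_13].
Definition Delta6 : set 'rV[R]_6 :=
  conv [set 0; P_31; Q_32_31; Q_23_21; T_31_13; R_1; V_31_23].

Definition Deltas (i : 'I_6) : set 'rV[R]_6 :=
  nth set0 [:: Delta1; Delta2; Delta3; Delta4; Delta5; Delta6] i.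

End the_polytope.

Arguments polytopeP R : clear implicits.
Arguments std_simplex R : clear implicits.
Arguments polytopeP11 R : clear implicits.
Arguments Deltas R i : clear implicits.

(* Main.v *)
Require Import Defs.
From HB Require Import structures.
From mathcomp Require Import all_boot all_order all_algebra all_fingroup.
From mathcomp Require Import all_classical all_reals all_analysis.
From mathcomp Require Import measurable_realfun ring lra.

Import Order.TTheory GRing.Theory Num.Theory.
Import numFieldNormedType.Exports.

Local Open Scope classical_set_scope.
Local Open Scope ring_scope.

(** Write L1, L2, L3 for the left-hand sides of the three inequalities that
    define the polytope, and call x12 + x23 + x31 = x13 + x32 + x21 the balance
    hyperplane.  The cone from the origin over the facet L1 = 1 is where L1
    dominates L2 and L3; truncated by L1 <= 1 and halved by the balance
    hyperplane, it is the polyhedron [cone_slice].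

    All simplices of the triangulation have the origin as a vertex, so each is
    the image of the corner simplex (nonnegative coordinates of sum at most 1)
    under the matrix of its six other vertices.  On all of these vertices L1
    equals 1; hence the barycentric coordinates of a point sum to L1, and the
    point of [cone_slice] lies in the simplex as soon as they are nonnegative.
    Comparing a few sums of coordinates of the point decides in which of the
    six simplices this happens ([cone_slice_cover]).  Conversely the simplices
    lie in the convex set that they have to cover because their vertices do.
    For each pair of simplices an explicit linear form is zero on the common
    vertices, negative on the other vertices of the first and positive on the
    other vertices of the second ([separated]); it cuts out the intersection as
    a common face ([separated_face]).

    For the volume, an invertible linear map multiplies volumes by the absolute
    value of its determinant ([rescales_unit]): Fubini gives this for a shear
    of the last coordinate and for the exchange of two adjacent coordinates,
    and every invertible matrix is a product of such maps by its LU
    decomposition.  So each simplex of the triangulation has volume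
    |det| / 6!, where the standard simplex has volume 1 / 6! by slicing
    ([simplicial_step]).  The six determinants have absolute values
    1/288, 1/144, 1/72, 1/144, 1/144, 1/288, of sum 1/24, and simplices overlap
    only within the separating hyperplanes, which are null sets
    ([Vol_hyperplane]).  Finally the six permutations of the indices 1, 2, 3
    permute the coordinates and the forms L1, L2, L3, odd permutations
    exchanging the sides of the balance hyperplane; the polytope is the union
    of the six images of [cone_slice], which again overlap only within
    hyperplanes, and 6 / 24 = 1 / 4. *)

(** * Convex hulls of the origin and finitely many points *)

Section convexity.
Context {R : realType}.

Lemma convexP {n} (S : set 'rV[R]_n) :
  convex_set S <-> forall x y (t : R), S x -> S y -> 0 < t -> t < 1 ->
    S (t *: x + (1 - t) *: y).
Proof.
split => [cS x y t Sx Sy t0 t1|cS].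
  have tI : Itv.spec (@Itv.num_sem R) (Itv.Real `[0%Z, 1%Z]) t.
    by apply/andP; split; [exact: gtr0_real|rewrite in_itv/= !ltW].
  have := cS x y (Itv.mk tI); rewrite !inE; exact.
apply/convex_setW => x y; rewrite !inE => Sx Sy k k0 k1; rewrite !inE.
exact: cS.
Qed.

Lemma conv_convex {n} (A : set 'rV[R]_n) : convex_set (Defs.conv A).
Proof.
apply/convexP => x y t Ax Ay t0 t1 S [cS AS].
by move/convexP : (cS); apply => //; [exact: Ax|exact: Ay].
Qed.

Lemma sub_conv {n} (A : set 'rV[R]_n) : A `<=` Defs.conv A.
Proof. exact: sub_smallest. Qed.

Lemma conv_sub {n} (A S : set 'rV[R]_n) :
  convex_set S -> A `<=` S -> Defs.conv A `<=` S.
Proof. exact: smallest_sub. Qed.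

Definition dot {n} (c x : 'rV[R]_n) : R := \sum_i c 0 i * x 0 i.

Lemma dotD n (c x y : 'rV[R]_n) : dot c (x + y) = dot c x + dot c y.
Proof. by rewrite -big_split; apply: eq_bigr => i _; rewrite mxE mulrDr. Qed.

Lemma dotZ n (c x : 'rV[R]_n) t : dot c (t *: x) = t * dot c x.
Proof. by rewrite mulr_sumr; apply: eq_bigr => i _; rewrite mxE mulrCA. Qed.

Lemma dotDl n (c d x : 'rV[R]_n) : dot (c + d) x = dot c x + dot d x.
Proof. by rewrite -big_split; apply: eq_bigr => i _; rewrite mxE mulrDl. Qed.

Lemma dotNl n (c x : 'rV[R]_n) : dot (- c) x = - dot c x.
Proof. by rewrite -sumrN; apply: eq_bigr => i _; rewrite mxE mulNr. Qed.

Lemma dot_mul m n (c : 'rV[R]_n) (y : 'rV[R]_m) (W : 'M[R]_(m, n)) :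
  dot c (y *m W) = \sum_i y 0 i * dot c (row i W).
Proof.
rewrite /dot; under eq_bigr do rewrite mxE mulr_sumr.
rewrite exchange_big; apply: eq_bigr => i _ /=.
by rewrite mulr_sumr; apply: eq_bigr => j _; rewrite mxE mulrCA.
Qed.

(** The sets of coefficients of convex combinations that give the remaining
    weight to the origin. *)
Definition corner m : set 'rV[R]_m :=
  [set y | (forall k, 0 <= y 0 k) /\ \sum_k y 0 k <= 1].

Definition corner_hull {m n} (W : 'M[R]_(m, n)) : set 'rV[R]_n :=
  [set y *m W | y in corner m].

Lemma corner_convex m : convex_set (corner m).
Proof.
apply/convexP => x y t [x0 x1] [y0 y1] t0 t1; split=> [k|].
  by rewrite !mxE addr_ge0// mulr_ge0// ?subr_ge0 ltW.
under eq_bigr do rewrite !mxE.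
rewrite big_split -!mulr_sumr /=.
have t1' : 0 <= 1 - t by rewrite subr_ge0 ltW.
apply: (@le_trans _ _ (t * 1 + (1 - t) * 1)).
  by apply: lerD; apply: ler_wpM2l => //; exact: ltW.
by rewrite -mulrDl subrKC mul1r.
Qed.

Lemma corner_hull_convex m n (W : 'M[R]_(m, n)) : convex_set (corner_hull W).
Proof.
apply/convexP => _ _ t [x Cx <-] [y Cy <-] t0 t1.
exists (t *: x + (1 - t) *: y).
  by move/convexP : (@corner_convex m); apply.
by rewrite mulmxDl !scalemxAl.
Qed.

(** The missing weight goes to the origin.  Only the points of nonzero weight
    have to lie in [S]; [separated_face] depends on this. *)
Lemma convex_comb_mem n (S : set 'rV[R]_n) : convex_set S -> S 0 ->
  forall m (y : 'I_m -> R) (v : 'I_m -> 'rV[R]_n),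
    (forall i, 0 <= y i) -> \sum_i y i <= 1 ->
    (forall i, y i != 0 -> S (v i)) -> S (\sum_i y i *: v i).
Proof.
move=> /convexP cS S0; elim=> [|m IH] y v y0 y1 Sv; first by rewrite big_ord0.
rewrite big_ord_recr /=; set a := y ord_max.
move: y1; rewrite big_ord_recr/= -/a => y1.
have s0 : 0 <= \sum_(i < m) y (widen_ord (leqnSn m) i) by exact: sumr_ge0.
have [a0|a0] := eqVneq a 0.
  rewrite a0 scale0r addr0; apply: IH => //; last by move=> i; exact: Sv.
  by move: y1; rewrite a0 addr0.
have [a1|a1] := eqVneq a 1.
  rewrite a1 scale1r big1 ?add0r; first exact: Sv.
  move=> i _; suff -> : y (widen_ord (leqnSn m) i) = 0 by rewrite scale0r.
  apply: (@psumr_eq0P _ _ xpredT (fun i => y (widen_ord (leqnSn m) i))) => //.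
  by apply/eqP; rewrite eq_le s0 andbT; move: y1; rewrite a1 gerDr.
have a_gt0 : 0 < a by rewrite lt_neqAle eq_sym a0 y0.
have a_lt1 : a < 1.
  by rewrite lt_neqAle a1 (le_trans _ y1)// lerDr.
have b0 : 0 < 1 - a by rewrite subr_gt0.
(* Rescale the first m weights by 1 - a, so that the induction hypothesis
   applies to them, and combine the result with the last point. *)
rewrite addrC.
have -> :
    \sum_(i < m) y (widen_ord (leqnSn m) i) *: v (widen_ord (leqnSn m) i) =
    (1 - a) *: \sum_(i < m) (y (widen_ord (leqnSn m) i) / (1 - a)) *:
       v (widen_ord (leqnSn m) i).
  rewrite scaler_sumr; apply: eq_bigr => i _.
  by rewrite scalerA mulrC divfK// gt_eqF.
apply: cS => //; first exact: Sv.
apply: IH => [i||i].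
- by rewrite divr_ge0// ltW.
- by rewrite -mulr_suml ler_pdivrMr// mul1r lerBrDr.
- by rewrite mulf_eq0 negb_or => /andP[yi _]; exact: Sv.
Qed.

Lemma convex_corner_mem m n (S : set 'rV[R]_n) (W : 'M[R]_(m, n)) y :
  convex_set S -> S 0 -> corner m y ->
  (forall i, y 0 i != 0 -> S (row i W)) -> S (y *m W).
Proof.
move=> cS S0 [y0 y1] Sv; rewrite mulmx_sum_row.
exact: convex_comb_mem.
Qed.

Lemma corner_hull0 m n (W : 'M[R]_(m, n)) : corner_hull W 0.
Proof.
exists 0; last by rewrite mul0mx.
by split => [k|]; rewrite ?big1 ?ler01// => *; rewrite mxE.
Qed.

Lemma corner_hull_row m n (W : 'M[R]_(m, n)) i : corner_hull W (row i W).
Proof.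
exists (delta_mx 0 i); last by rewrite -rowE.
split=> [k|]; first by rewrite !mxE eqxx/=; case: (_ == _).
rewrite (bigD1 i)//= big1 ?mxE ?eqxx ?addr0// => j ji.
by rewrite mxE (negbTE ji) andbF.
Qed.

Lemma corner_hullE m n (W : 'M[R]_(m, n)) :
  corner_hull W = Defs.conv (0 |` range (fun i => row i W)).
Proof.
apply/seteqP; split => [_ [y Cy <-]|].
  apply: convex_corner_mem => //; first exact: conv_convex.
    by apply: sub_conv; left.
  by move=> i _; apply: sub_conv; right; exists i.
apply: conv_sub; first exact: corner_hull_convex.
move=> _ [->|[i _ <-]]; [exact: corner_hull0|exact: corner_hull_row].
Qed.

Lemma corner_hull_simplex n (W : 'M[R]_n) :
  W \in unitmx -> is_simplex (corner_hull W).
Proof.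
move=> Wu; exists n.
pose v (i : 'I_n.+1) := oapp (fun j => row j W) 0 (unlift ord0 i).
exists v; split.
  move=> a; rewrite !big_ord_recl /v unlift_none /= scaler0 add0r => a0.
  under eq_bigr do rewrite liftK/=.
  move=> H.
  have : (\row_i a (lift ord0 i)) *m W = 0.
    by rewrite mulmx_sum_row -[RHS]H; apply: eq_bigr => i _; rewrite mxE.
  move=> /(congr1 (mulmx^~ (invmx W))); rewrite mulmxK// mul0mx => /rowP E.
  have E' i : a (lift ord0 i) = 0 by have := E i; rewrite !mxE.
  move=> i; case: (unliftP ord0 i) => [j|] -> //.
  by move: a0; rewrite big1 ?addr0.
rewrite corner_hullE; congr Defs.conv; apply/seteqP; split.
  move=> _ [->|[i _ <-]]; first by exists ord0 => //; rewrite /v unlift_none.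
  by exists (lift ord0 i) => //; rewrite /v liftK.
move=> _ [i _ <-]; rewrite /v; case: (unlift ord0 i) => [j|]; last by left.
by right; exists j.
Qed.

(** A point of both sets lies on the hyperplane of [c].  Conversely, a point of
    the hull that lies on this hyperplane puts weight only on rows of [W] that
    lie on it, because a sum of nonpositive terms vanishes only termwise; those
    rows belong to [S]. *)
Lemma separated_face m n (c : 'rV[R]_n) (W : 'M[R]_(m, n)) (S : set 'rV[R]_n) :
  convex_set S -> S 0 -> (forall x, S x -> 0 <= dot c x) ->
  (forall i, dot c (row i W) <= 0) ->
  (forall i, dot c (row i W) = 0 -> S (row i W)) ->
  is_face (corner_hull W `&` S) (corner_hull W).
Proof.
move=> cS S0 Sc Wc WS.
have Wc' x : corner_hull W x -> dot c x <= 0.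
  move=> [y [y0 _] <-]; rewrite dot_mul; apply: sumr_le0 => i _.
  exact: mulr_ge0_le0.
exists c, 0; split => //.
apply/seteqP; split => [x [Wx Sx]|x [Wx xc]]; split => //.
  by apply/eqP; rewrite eq_le Wc' //= Sc.
move: Wx xc => [y Cy <-]; rewrite -/(dot c _) dot_mul => E.
have {}E i : y 0 i * dot c (row i W) = 0.
  apply/eqP; rewrite -oppr_eq0; apply/eqP.
  apply: (@psumr_eq0P _ _ xpredT (fun i => - (y 0 i * dot c (row i W)))) => //.
    by move=> k _; rewrite oppr_ge0 mulr_ge0_le0//; case: Cy.
  by rewrite sumrN E oppr0.
apply: convex_corner_mem => // i yi; apply: WS.
by apply/eqP; have /eqP := E i; rewrite mulf_eq0 (negbTE yi).
Qed.

End convexity.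

(** * Products with the line, and maps that scale a measure *)

(** The pushforward as a measure, in the form that the uniqueness theorems for
    measures take as an argument. *)
Lemma pushforward_is_measure {d1 d2} {T1 : measurableType d1}
    {T2 : measurableType d2} {R : realType} (m : {measure set T1 -> \bar R})
    (f : T1 -> T2) : measurable_fun setT f ->
  exists m' : {measure set T2 -> \bar R}, forall A, m' A = m (f @^-1` A).
Proof.
by move=> mf; unshelve eexists (pushforward m f : {measure set T2 -> \bar R}).
Qed.

Section line_product.
Context {d} {T : measurableType d} {R : realType}.
Local Notation mu := (@lebesgue_measure R).
Local Notation RM := (measurableTypeR R).
Variable m : {sigma_finite_measure set T -> \bar R}.

(** The product with Lebesgue measure under a name of its own, which carries
    the structure of a sigma-finite measure for iterated products. *)
Definition line_prod : set (T * RM) -> \bar R := (m \x mu)%E.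

HB.instance Definition _ := Measure.on line_prod.

Lemma line_prod_sigma_finite : sigma_finite setT line_prod.
Proof.
have /sigma_finiteP[F [TF ndF Foo]] := sigma_finiteT m.
have /sigma_finiteP[G [TG ndG Goo]] := sigma_finiteT mu.
exists (fun n => F n `*` G n).
  rewrite -setXTT TF TG predeqE => -[x y]; split.
    move=> [/= [n _ Fnx] [k _ Gky]]; exists (maxn n k) => //; split.
    - by move: x Fnx; exact/subsetPset/ndF/leq_maxl.
    - by move: y Gky; exact/subsetPset/ndG/leq_maxr.
  by move=> [n _ []/= ? ?]; split; exists n.
move=> k; have [? ?] := Foo k; have [? ?] := Goo k.
split; first exact: measurableX.
by rewrite /line_prod product_measure1E// lte_mul_pinfty// ge0_fin_numE.
Qed.

HB.instance Definition _ :=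
  Measure_isSigmaFinite.Build _ _ _ line_prod line_prod_sigma_finite.

Lemma line_prodE A B : measurable A -> measurable B ->
  line_prod (A `*` B) = (m A * mu B)%E.
Proof. exact: product_measure1E. Qed.

Lemma line_prod_unique (m' : {measure set (T * RM) -> \bar R}) :
  (forall A B, measurable A -> measurable B -> m' (A `*` B) = (m A * mu B)%E) ->
  forall X, measurable X -> line_prod X = m' X.
Proof. exact: product_measure_unique. Qed.

End line_product.

Section scaling.
Context {R : realType}.
Local Notation mu := (@lebesgue_measure R).
Local Notation RM := (measurableTypeR R).

Definition scales {d} {T : measurableType d} (m : set T -> \bar R)
    (phi : T -> T) (k : R) :=
  measurable_fun setT phi /\
  forall B, measurable B -> m (phi @^-1` B) = (k%:E * m B)%E.

Lemma measurable_affine (c g : R) :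
  measurable_fun setT (fun y : RM => c * y + g : RM).
Proof. by apply: measurable_funD => //; apply: measurable_funM. Qed.

Lemma affine_ocitv (c g a b : R) : c != 0 ->
  mu ((fun y : RM => c * y + g) @^-1` `]a, b]) = (`|c|^-1%:E * mu `]a, b])%E.
Proof.
move=> c0; rewrite !lebesgue_measure_itv/= lte_fin.
case: (ltgtP c 0) c0 => // [cn|cp] _.
- have -> : (fun y : RM => c * y + g) @^-1` `]a, b]%classic =
    `[(b - g) / c, (a - g) / c[%classic.
    apply/seteqP; split => y /=; rewrite !in_itv/= => /andP[h1 h2]; apply/andP;
      split; move: h1 h2; rewrite ?ler_ndivrMr ?ltr_ndivlMr// mulrC; lra.
  rewrite lebesgue_measure_itv/= lte_fin ltr_nM2r ?invr_lt0// ltrD2r.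
  case: ifP => ab; last by rewrite mule0.
  rewrite -!EFinB -EFinM; congr EFin; rewrite ltr0_norm// invrN; field.
  by rewrite lt_eqF.
- have -> : (fun y : RM => c * y + g) @^-1` `]a, b]%classic =
    `](a - g) / c, (b - g) / c]%classic.
    apply/seteqP; split => y /=; rewrite !in_itv/= => /andP[h1 h2]; apply/andP;
      split; move: h1 h2; rewrite ?ler_pdivlMr ?ltr_pdivrMr// mulrC; lra.
  rewrite lebesgue_measure_itv/= lte_fin ltr_pM2r ?invr_gt0// ltrD2r.
  case: ifP => ab; last by rewrite mule0.
  rewrite -!EFinB -EFinM; congr EFin; rewrite gtr0_norm//; field.
  by rewrite gt_eqF.
Qed.

Lemma lebesgue_affine (c g : R) (B : set RM) : c != 0 -> measurable B ->
  mu ((fun y : RM => c * y + g) @^-1` B) = (`|c|^-1%:E * mu B)%E.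
Proof.
move=> c0 mB; have nc0 : `|c| != 0 by rewrite normr_eq0.
have [m1 m1E] := pushforward_is_measure mu _ (measurable_affine c g).
pose m2 : {measure set RM -> \bar R} := mscale (NngNum (normr_ge0 c)) m1.
have E A : m2 A = (`|c|%:E * mu ((fun y : RM => c * y + g)%R @^-1` A))%E.
  by rewrite -m1E.
have -> : mu B = m2 B.
  apply: lebesgue_measure_unique => // _ [[a b] _ <-].
  by rewrite E affine_ocitv// muleA -EFinM divff// mul1e.
by rewrite E muleA -EFinM mulVf// mul1e.
Qed.

Section prod.
Context {d} {T : measurableType d}.
Variable m : {sigma_finite_measure set T -> \bar R}.

Lemma measurable_shear (c : R) (g : T -> R) : measurable_fun setT g ->
  measurable_fun setT (fun u : T * RM => (u.1, c * u.2 + g u.1) : T * RM).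
Proof.
move=> mg; apply/measurable_fun_pairP; split => /=; first exact: measurable_fst.
apply: measurable_funD.
  by apply: measurable_funM => //; exact: measurable_snd.
exact: measurableT_comp measurable_fst.
Qed.

(** On each vertical line a shear is an affine map of the line. *)
Lemma scales_shear (c : R) (g : T -> R) : c != 0 -> measurable_fun setT g ->
  scales (line_prod m)
    (fun u : T * RM => (u.1, c * u.2 + g u.1) : T * RM) `|c|^-1.
Proof.
move=> c0 mg; split; first exact: measurable_shear.
move=> B mB; rewrite /line_prod /product_measure1 -ge0_integralZl//; last first.
  exact: measurable_fun_xsection.
apply: eq_integral => t _ /=.
by rewrite -(lebesgue_affine c (g t))//; exact: measurable_xsection.
Qed.

(** The measure of a set is the integral over the base of the lengths of its
    vertical sections; [phi] moves these sections, and pushing [m] forward by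
    [phi] multiplies the integral by [k]. *)
Lemma scales_lift (phi : T -> T) (k : R) : 0 <= k -> scales m phi k ->
  scales (line_prod m) (fun u : T * RM => (phi u.1, u.2) : T * RM) k.
Proof.
move=> k0 [mphi sphi].
have mpsi : measurable_fun setT (fun u : T * RM => (phi u.1, u.2) : T * RM).
  apply/measurable_fun_pairP; split => /=; last exact: measurable_snd.
  exact: measurableT_comp mphi measurable_fst.
split=> // B mB.
rewrite /line_prod /product_measure1.
have mX := measurable_fun_xsection mu mB.
transitivity (\int[pushforward m phi]_x (mu \o xsection B) x)%E.
  by rewrite ge0_integral_pushforward.
have -> : (k%:E * \int[m]_x (mu \o xsection B) x =
   \int[mscale (NngNum k0) m]_x (mu \o xsection B) x)%E.
  by rewrite ge0_integral_mscale.
apply: eq_measure_integral => A mA _.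
exact: sphi.
Qed.

End prod.
End scaling.

Section swap.
Context {R : realType}.
Local Notation mu := (@lebesgue_measure R).
Local Notation RM := (measurableTypeR R).

Lemma scales_swap2 : scales (line_prod mu) (fun u : RM * RM => (u.2, u.1)) 1.
Proof.
have ms : measurable_fun setT (fun u : RM * RM => (u.2, u.1)).
  exact: measurable_swap.
split=> // B mB; rewrite mul1e.
have [m' m'E] := pushforward_is_measure (line_prod mu) _ ms.
rewrite -m'E; apply/esym/line_prod_unique => // X Y mX mY.
rewrite m'E -[RHS]muleC -line_prodE//.
by congr ((line_prod mu) _); apply/seteqP; split => -[x y] /= [].
Qed.

Lemma integral_subXn_fact (n : nat) (r : R) : 0 <= r ->
  (\int[mu]_(y in `[0%R, r]) ((r - y) ^+ n / n`!%:R)%:E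
   = (r ^+ n.+1 / n.+1`!%:R)%:E)%E.
Proof.
rewrite le_eqVlt => /predU1P[<-|r0].
  by rewrite set_itv1 integral_set1 expr0n mul0r.
have n0 : n.+1%:R != 0 :> R by rewrite pnatr_eq0.
have f0 : n`!%:R != 0 :> R by rewrite pnatr_eq0 -lt0n fact_gt0.
pose p : {poly R} := (- (n.+1`!%:R)^-1) *: (r%:P - 'X) ^+ n.+1.
have pE y : p.[y] = - ((r - y) ^+ n.+1 / n.+1`!%:R).
  by rewrite !hornerE mulNr mulrC.
have p'E y : p^`().[y] = (r - y) ^+ n / n`!%:R.
  rewrite derivZ deriv_exp derivB derivC derivX sub0r.
  rewrite !hornerE hornerMn !hornerE.
  rewrite factS natrM -mulr_natr; field.
  by rewrite f0 addrC natr1 n0.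
have cp (q : {poly R}) : continuous (horner q).
  move=> y; apply: differentiable_continuous; apply/derivable1_diffP.
  exact: ex_derive.
transitivity (\int[mu]_(y in `[0%R, r]) (p^`().[y])%:E)%E.
  by apply: eq_integral => y _; rewrite p'E.
rewrite (@continuous_FTC2 _ _ (horner p))//.
- by rewrite -EFinB !pE subrr expr0n/= mul0r oppr0 sub0r opprK addr0.
- exact: continuous_subspaceT (cp _).
- split => [y _||]; first exact: ex_derive.
  + apply: cvg_at_right_filter; exact: cp.
  + apply: cvg_at_left_filter; exact: cp.
- by move=> y _; rewrite derive1E; exact: derive_val.
Qed.

Section prod.
Context {d} {T : measurableType d}.
Variable m : {sigma_finite_measure set T -> \bar R}.

(** By uniqueness of product measures it suffices to measure the preimage of a
    rectangle [X] times [Y]: the section over a point [(t, a)] is that of [X]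
    over [t] when [a] is in [Y] and empty otherwise, and Tonelli integrates the
    two factors separately. *)
Lemma scales_swap :
  scales (line_prod (line_prod m))
    (fun u : T * RM * RM => (u.1.1, u.2, u.1.2)) 1.
Proof.
have ms : measurable_fun setT
    (fun u : T * RM * RM => (u.1.1, u.2, u.1.2) : T * RM * RM).
  apply/measurable_fun_pairP; split => /=.
    apply/measurable_fun_pairP; split => /=; last exact: measurable_snd.
    exact: measurableT_comp measurable_fst measurable_fst.
  exact: measurableT_comp measurable_snd measurable_fst.
split=> // B mB; rewrite mul1e.
have [m' m'E] := pushforward_is_measure (line_prod (line_prod m)) _ ms.
rewrite -m'E; apply: esym.
apply: line_prod_unique => // X Y mX mY.
rewrite m'E.
have mXs := measurable_fun_xsection mu mX.
pose f (u : T * RM) := (mu (xsection X u.1) * (\1_Y u.2)%:E)%E.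
transitivity (\int[line_prod m]_u f u)%E.
  apply: eq_integral => -[t a] _; rewrite /f /= indicE.
  have [aY|aY] := boolP (a \in Y).
    rewrite inE in aY; rewrite mule1; congr mu; apply/seteqP.
    by split => b /=; rewrite /xsection/= !inE // => -[].
  rewrite mule0 -[RHS](@measure0 _ _ _ mu); congr mu; apply/seteqP.
  split => b //=; rewrite /xsection/= inE => -[] /= _.
  by rewrite notin_setE in aY => /aY.
have mf : measurable_fun setT f.
  apply: emeasurable_funM.
    exact: (measurableT_comp mXs measurable_fst).
  apply/measurable_EFinP.
  by apply: measurableT_comp measurable_snd; exact: measurable_indic.
rewrite [LHS](fubini_tonelli1 _ mf)//; last first.
  by move=> u; rewrite mule_ge0// lee_fin.
rewrite /fubini_F /f /=.
transitivity (\int[m]_x (mu (xsection X x) * mu Y))%E.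
  apply: eq_integral => t _.
  rewrite ge0_integralZl//; last exact/measurable_EFinP/measurable_indic.
  by rewrite integral_indic// setIT.
by rewrite ge0_integralZr.
Qed.

End prod.
End swap.

(** * The volume of the standard simplex, by slicing *)

Section simplex.
Context {R : realType} {d} {T : measurableType d}.
Local Notation mu := (@lebesgue_measure R).
Local Notation RM := (measurableTypeR R).
Variable m : {sigma_finite_measure set T -> \bar R}.

(** The invariant of the induction on the dimension [n]: in the application [D]
    is the nonnegative orthant and [s] the sum of the coordinates, but the next
    step sees only how [s] is distributed on [D]. *)
Definition simplicial {d'} {T' : measurableType d'} (m' : set T' -> \bar R)
    (D : set T') (s : T' -> R) (n : nat) :=
  [/\ measurable D, measurable_fun setT s, forall t, D t -> 0 <= s t
    & forall r : R, 0 <= r ->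
      m' (D `&` [set t | s t <= r]) = (r ^+ n / n`!%:R)%:E].

Lemma simplicial_line : simplicial mu `[0, +oo[%classic (fun y : RM => y) 1.
Proof.
split => [||y /=|r r0]; [exact: measurable_itv|exact: measurable_id| |].
  by rewrite in_itv andbT.
have -> : `[0, +oo[%classic `&` [set y : RM | y <= r] = `[0, r]%classic.
  by apply/seteqP; split => y /=; rewrite !in_itv/= andbT => /andP.
rewrite lebesgue_measure_itv/= lte_fin expr1 divr1 sube0.
by move: r0; rewrite le_eqVlt => /predU1P[<-|->//]; rewrite ltxx.
Qed.

(** The slice at height [y] of the new sublevel set for [r] is the old sublevel
    set for [r - y], so Cavalieri gives the integral of [(r - y) ^+ n / n`!]
    over [0 <= y <= r]. *)
Lemma simplicial_step (D : set T) (s : T -> R) (n : nat) :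
  simplicial m D s n ->
  simplicial (line_prod m) [set u : T * RM | D u.1 /\ 0 <= u.2]
    (fun u => s u.1 + u.2) n.+1.
Proof.
move=> [mD ms s0 IH].
have mD' : measurable [set u : T * RM | D u.1 /\ 0 <= u.2].
  have -> : [set u : T * RM | D u.1 /\ 0 <= u.2] = D `*` `[0, +oo[%classic.
    by apply/seteqP; split => u /=; rewrite in_itv/= andbT.
  by apply: measurableX => //; exact: measurable_itv.
have mS : measurable_fun setT (fun u : T * RM => s u.1 + u.2).
  apply: measurable_funD; last exact: measurable_snd.
  exact: measurableT_comp ms measurable_fst.
split => // [u [/s0 su u0]|r r0]; first exact: addr_ge0.
set X := (X in line_prod m X).
have mX : measurable X.
  apply: measurableI => //.
  have := mS measurableT `]-oo, r]%classic (measurable_itv _).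
  by rewrite setTI; congr measurable; apply/seteqP;
    split => u /=; rewrite in_itv.
(* Integrate over the new coordinate last: the other order of integration. *)
have -> : (line_prod m) X = (m \x^ mu)%E X.
  by apply: line_prod_unique => // A B mA mB; exact: product_measure2E.
rewrite -integral_subXn_fact// [RHS]integral_mkcond /product_measure2.
apply: eq_integral => y _ /=; rewrite patchE mem_setE in_itv /=.
case: ifPn => [/andP[y0 yr]|ny].
  rewrite -IH ?subr_ge0//; congr (m _); apply/seteqP; split => t /=;
    rewrite /ysection/= inE /X /= lerBrDr; tauto.
rewrite -[RHS](@measure0 _ _ _ m); congr (m _); apply/seteqP; split => // t.
rewrite /ysection/= inE /X /= => -[[/s0 st y0] sy]; move: ny.
by rewrite y0 /= (le_trans _ sy)// lerDr.
Qed.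

End simplex.

(** * Volumes under linear maps of six-dimensional space *)

Section R6.
Context {R : realType}.
Local Notation mu := (@lebesgue_measure R).
Local Notation RM := (measurableTypeR R).

Lemma sum6 (f : 'I_6 -> R) : \sum_i f i =
  f (@Ordinal 6 0 isT) + f (@Ordinal 6 1 isT) + f (@Ordinal 6 2 isT)
  + f (@Ordinal 6 3 isT) + f (@Ordinal 6 4 isT) + f (@Ordinal 6 5 isT).
Proof.
rewrite !big_ord_recl big_ord0 addr0 !addrA.
by congr (_ + _ + _ + _ + _ + _); congr (f _); exact: val_inj.
Qed.

(** The iterated products get names one dimension at a time, so that each factor
    is a measurable type by its name alone. *)
Definition M2 : measurableType _ := (RM * RM)%type.
Definition mu2 : {sigma_finite_measure set M2 -> \bar R} := line_prod mu.
Definition M3 : measurableType _ := (M2 * RM)%type.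
Definition mu3 : {sigma_finite_measure set M3 -> \bar R} := line_prod mu2.
Definition M4 : measurableType _ := (M3 * RM)%type.
Definition mu4 : {sigma_finite_measure set M4 -> \bar R} := line_prod mu3.
Definition M5 : measurableType _ := (M4 * RM)%type.
Definition mu5 : {sigma_finite_measure set M5 -> \bar R} := line_prod mu4.
Definition M6 : measurableType _ := (M5 * RM)%type.
Definition mu6 : {sigma_finite_measure set M6 -> \bar R} := line_prod mu5.

Definition row6 (u : M6) : 'rV[R]_6 :=
  pt6 u.1.1.1.1.1 u.1.1.1.1.2 u.1.1.1.2 u.1.1.2 u.1.2 u.2.

Definition meas6 (A : set 'rV[R]_6) := measurable (row6 @^-1` A).

Lemma VolE (A : set 'rV[R]_6) : Vol A = mu6 (row6 @^-1` A).
Proof.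
transitivity (mu6
  [set u | let: (a, b, c, d, e, f) := u in A (pt6 a b c d e f)]).
  by [].
by congr (mu6 _); apply/seteqP; split => -[[[[[a b] c] d] e] f].
Qed.

(** The set on the left is the preimage of [A] under [M], hence the inverse of
    the determinant. *)
Definition rescales (M : 'M[R]_6) := forall A, meas6 A ->
  meas6 [set x | A (x *m M)] /\
  Vol [set x | A (x *m M)] = ((`|\det M|^-1)%:E * Vol A)%E.

Lemma rescales_mul M N : rescales M -> rescales N -> rescales (M *m N).
Proof.
move=> gM gN A mA; have [mA1 VA1] := gN _ mA; have [mA2 VA2] := gM _ mA1.
have -> : [set x | A (x *m (M *m N))] =
    [set x | [set y | A (y *m N)] (x *m M)].
  by apply/seteqP; split => x /=; rewrite mulmxA.
by rewrite VA2 VA1 muleA -EFinM det_mulmx normrM invfM.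
Qed.

Lemma rescales1 : rescales 1%:M.
Proof.
move=> A mA.
have -> : [set x | A (x *m 1%:M)] = A.
  by apply/seteqP; split => x /=; rewrite mulmx1.
by rewrite det1 normr1 invr1 mul1e.
Qed.

Lemma scales_rescales phi M : scales mu6 phi (`|\det M|^-1) ->
  (forall u, row6 (phi u) = row6 u *m M) -> rescales M.
Proof.
move=> [mphi sphi] E A mA.
have EA : row6 @^-1` [set x | A (x *m M)] = phi @^-1` (row6 @^-1` A).
  by rewrite /preimage /=; apply/funext => u /=; rewrite E.
rewrite !VolE /meas6 EA; split; last exact: sphi.
by rewrite -[X in measurable X]setTI; apply: mphi.
Qed.

Lemma mul_tperm_mx n (x : 'rV[R]_n) i j k :
  (x *m tperm_mx i j) 0 k = x 0 (tperm i j k).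
Proof. by rewrite /tperm_mx -[tperm i j]invgK -col_permE mxE !tpermV. Qed.

Lemma norm_det_perm n (s : 'S_n) : `|\det (perm_mx s : 'M[R]_n)| = 1.
Proof. by rewrite det_perm normrX normrN normr1 expr1n. Qed.

(** Transpositions compose by conjugation: (i k) = (i j)(j k)(i j). *)
Lemma tperm_chain n (P : 'M[R]_n -> Prop) (i j k : 'I_n) :
  P 1%:M -> (forall M N, P M -> P N -> P (M *m N)) ->
  P (tperm_mx i j) -> P (tperm_mx j k) -> P (tperm_mx i k).
Proof.
move=> P1 PM Pij Pjk.
have [->|ij] := eqVneq i j; first by [].
have [<-|jk] := eqVneq j k; first by [].
have [->|ik] := eqVneq i k; first by rewrite /tperm_mx tperm1 perm_mx1.
have -> : tperm_mx i k =
    tperm_mx i j *m tperm_mx j k *m tperm_mx i j :> 'M[R]_n.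
  rewrite /tperm_mx -!perm_mxM; congr perm_mx.
  have <- : (tperm j k ^ tperm i j)%g = tperm i k.
    by rewrite tpermJ tpermR tpermD.
  by rewrite conjgE tpermV mulgA.
exact: PM _ _ (PM _ _ Pij Pjk) Pij.
Qed.

(** The map [x *m col_repl j v] replaces the coordinate [j] of [x] by the linear
    form with coefficients [v] and keeps the others. *)
Definition col_repl {n} (j : 'I_n) (v : 'I_n -> R) : 'M[R]_n :=
  \matrix_(r, s) if s == j then v r else (r == s)%:R.

Lemma det_col_repl_last n (v : 'I_n.+1 -> R) :
  \det (col_repl ord_max v) = v ord_max.
Proof.
rewrite -det_tr det_trig.
  rewrite (bigD1 ord_max)//= !mxE eqxx big1 ?mulr1// => i iN.
  by rewrite !mxE (negbTE iN) eqxx.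
apply/is_trig_mxP => i j ij; rewrite !mxE; case: ifPn => [/eqP iE|_].
  by move: ij; rewrite iE ltnNge -ltnS ltn_ord.
by case: eqVneq ij => [->|//]; rewrite ltnn.
Qed.

Lemma col_repl_tperm n (i j : 'I_n) v :
  col_repl i v = tperm_mx i j *m col_repl j (v \o tperm i j) *m tperm_mx i j.
Proof.
apply/matrixP => r s; rewrite -row_permE.
rewrite /tperm_mx -[X in _ *m perm_mx X]tpermV -col_permE !mxE /= tpermK.
by rewrite -{2}(tpermL i j) !(inj_eq perm_inj).
Qed.

Lemma rescales_adjacent :
  [/\ rescales (tperm_mx (@Ordinal 6 0 isT) (@Ordinal 6 1 isT)),
      rescales (tperm_mx (@Ordinal 6 1 isT) (@Ordinal 6 2 isT)),
      rescales (tperm_mx (@Ordinal 6 2 isT) (@Ordinal 6 3 isT)),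
      rescales (tperm_mx (@Ordinal 6 3 isT) (@Ordinal 6 4 isT))
    & rescales (tperm_mx (@Ordinal 6 4 isT) (@Ordinal 6 5 isT))].
Proof.
have tE (a b k : 'I_6) :
    tperm a b k = if k == a then b else if k == b then a else k.
  by case: tpermP => [->|->|/eqP/negbTE-> /eqP/negbTE->];
    rewrite ?eqxx//; case: eqP.
have adj (phi : M6 -> M6) a b : scales mu6 phi 1 ->
    (forall u k, row6 (phi u) 0 k = row6 u 0 (tperm a b k)) ->
    rescales (tperm_mx a b).
  move=> sphi E; apply: (@scales_rescales phi); rewrite ?norm_det_perm ?invr1//.
  by move=> u; apply/rowP => k; rewrite mul_tperm_mx E.
have lift d T m phi := @scales_lift R d T m phi 1 ler01.
have lift5 := lift _ _ mu5; have lift4 phi h := lift5 _ (lift _ _ mu4 phi h).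
have lift3 phi h := lift4 _ (lift _ _ mu3 phi h).
have s01 := lift3 _ (lift _ _ mu2 _ (@scales_swap2 R)).
have s12 := lift3 _ (scales_swap mu).
have s23 := lift4 _ (scales_swap mu2).
have s34 := lift5 _ (scales_swap mu3).
have s45 := scales_swap mu4.
split; [apply: (adj _ _ _ s01)|apply: (adj _ _ _ s12)|apply: (adj _ _ _ s23)
  |apply: (adj _ _ _ s34)|apply: (adj _ _ _ s45)] =>
  u -[[|[|[|[|[|[|//]]]]]] lt]; by rewrite tE !mxE.
Qed.

Lemma rescales_tperm i j : rescales (tperm_mx i j).
Proof.
have ch a b c := @tperm_chain 6 rescales a b c rescales1 rescales_mul.
have sym a b : rescales (tperm_mx a b) -> rescales (tperm_mx b a).
  by rewrite /tperm_mx tpermC.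
have [a01 a12 a23 a34 a45] := rescales_adjacent.
suff H k : rescales (tperm_mx (@Ordinal 6 0 isT) k).
  by apply: (ch _ (@Ordinal 6 0 isT)) => //; exact: sym.
have E k' (l l' : (k' < 6)%N) : Ordinal l = Ordinal l' by exact: val_inj.
have a00 : rescales (tperm_mx (@Ordinal 6 0 isT) (@Ordinal 6 0 isT)).
  by rewrite /tperm_mx tperm1 perm_mx1; exact: rescales1.
have a02 := ch _ _ _ a01 a12; have a03 := ch _ _ _ a02 a23.
have a04 := ch _ _ _ a03 a34; have a05 := ch _ _ _ a04 a45.
by case: k => -[|[|[|[|[|[|//]]]]]] lt; rewrite (E _ lt isT).
Qed.

Lemma rescales_perm (s : 'S_6) : rescales (perm_mx s).
Proof.
have [ts -> _] := prod_tpermP s.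
elim: ts => [|t ts IH]; first by rewrite big_nil perm_mx1; exact: rescales1.
by rewrite big_cons perm_mxM; apply: rescales_mul => //; exact: rescales_tperm.
Qed.

(** After an exchange of coordinates the replaced coordinate is the last one,
    and the map is a shear. *)
Lemma rescales_col_repl j (v : 'I_6 -> R) : v j != 0 -> rescales (col_repl j v).
Proof.
move=> vj; rewrite (col_repl_tperm _ j ord_max).
apply: rescales_mul; last exact: rescales_tperm.
apply: rescales_mul; first exact: rescales_tperm.
have wE : (v \o tperm j ord_max) ord_max = v j by rewrite /= tpermR.
move: (v \o _) wE vj => w <- w0.
pose g (t : M5) : R :=
  w (@Ordinal 6 0 isT) * t.1.1.1.1 + w (@Ordinal 6 1 isT) * t.1.1.1.2
  + w (@Ordinal 6 2 isT) * t.1.1.2 + w (@Ordinal 6 3 isT) * t.1.2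
  + w (@Ordinal 6 4 isT) * t.2.
apply: (@scales_rescales (fun u => (u.1, w ord_max * u.2 + g u.1))).
  rewrite det_col_repl_last; apply: (@scales_shear _ _ _ mu5 _ g w0).
  have f5 : measurable_fun setT (fun t : M5 => t.1) by exact: measurable_fst.
  have f4 : measurable_fun setT (fun t : M5 => t.1.1).
    exact: (measurableT_comp (@measurable_fst _ _ M3 RM) f5).
  have f3 : measurable_fun setT (fun t : M5 => t.1.1.1).
    exact: measurableT_comp (@measurable_fst _ _ M2 RM) f4.
  have mZ (a : R) (h : M5 -> R) : measurable_fun setT h ->
      measurable_fun setT (fun t : M5 => a * h t).
    by move=> mh; exact: measurable_funM.
  apply: measurable_funD; last by apply: mZ; exact: measurable_snd.
  apply: measurable_funD.
    apply: measurable_funD.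
      apply: measurable_funD; apply: mZ.
        exact: measurableT_comp (@measurable_fst _ _ RM RM) f3.
      exact: measurableT_comp (@measurable_snd _ _ RM RM) f3.
    by apply: mZ; exact: measurableT_comp (@measurable_snd _ _ M2 RM) f4.
  by apply: mZ; exact: measurableT_comp (@measurable_snd _ _ M3 RM) f5.
have om : ord_max = @Ordinal 6 5 isT by exact: val_inj.
move=> u; apply/rowP => k; rewrite [RHS]mxE sum6 !mxE om /g.
case: k => -[|[|[|[|[|[|//]]]]]] lt /=;
  rewrite ?(mulr0, mulr1, add0r, addr0)//.
by ring.
Qed.

(** For lower triangular [L] the coordinate [j] of [x *m L] depends only on the
    coordinates of [x] from [j] on, so the coordinates can be replaced one at a
    time from the first to the last: each step uses values not yet replaced. *)
Lemma rescales_trig (L : 'M[R]_6) : is_trig_mx L -> L \in unitmx -> rescales L.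
Proof.
move=> /is_trig_mxP tL uL.
have dL j : L j j != 0.
  move: uL; rewrite unitmxE det_trig; last exact/is_trig_mxP.
  rewrite unitfE; apply: contra => /eqP Lj.
  by apply/prodf_eq0; exists j; rewrite ?Lj.
pose P k : 'M[R]_6 := \matrix_(r, s) if (s < k)%N then L r s else (r == s)%:R.
have PS (j : 'I_6) : P j.+1 = P j *m col_repl j (L^~ j).
  apply/matrixP => r s; rewrite !mxE ltnS leq_eqVlt.
  have [->|sj] := eqVneq s j.
    rewrite eqxx /=.
    rewrite (eq_bigr (fun t => if t == r then L r j else 0)); last first.
      move=> t _; rewrite !mxE eqxx; case: ifP => [tj|_].
        by rewrite (tL t j tj) mulr0; case: eqP => [<-|//]; rewrite tL.
      by rewrite eq_sym; case: eqP => [->|_]; rewrite ?mul1r ?mul0r.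
    by rewrite -big_mkcond big_pred1_eq.
  rewrite (negbTE sj : (s == j :> nat) = false) /=.
  rewrite (bigD1 s)//= !mxE (negbTE sj) eqxx mulr1 big1 ?addr0// => t ts.
  by rewrite !mxE (negbTE sj) (negbTE ts) mulr0.
have gP k : (k <= 6)%N -> rescales (P k).
  elim: k => [_|k IH k6].
    have -> : P 0%N = 1%:M by apply/matrixP => r s; rewrite !mxE.
    exact: rescales1.
  rewrite (PS (Ordinal k6)); apply: rescales_mul; first exact/IH/ltnW.
  exact: rescales_col_repl.
have -> : L = P 6%N by apply/matrixP => r s; rewrite mxE ltn_ord.
exact: gP.
Qed.

(** The LU decomposition with pivoting; reversing the order of the coordinates
    makes the upper triangular factor lower triangular. *)
Lemma trig_decomposition n (M : 'M[R]_n.+1) : M \in unitmx ->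
  exists (s w : 'S_n.+1) (L L' : 'M[R]_n.+1),
  [/\ M = perm_mx s *m (L *m (perm_mx w *m L' *m perm_mx w)),
      is_trig_mx L, L \in unitmx, is_trig_mx L' & L' \in unitmx].
Proof.
move=> uM.
have /is_perm_mxP[s Ps] := cormen_lup_perm M.
move: (cormen_lup_correct M) (cormen_lup_detL M).
move: (@cormen_lup_lower _ _ M) (@cormen_lup_upper _ _ M) Ps.
case: (cormen_lup M) => -[P L] U /= Ll Uu -> PE dL.
have {}PE : perm_mx s *m M = L *m U := PE.
pose w : 'S_n.+1 := perm (@rev_ord_inj n.+1).
have wV : (w^-1)%g = w.
  apply/eqP; rewrite eq_invg_mul; apply/eqP/permP => i.
  by rewrite permM !permE /= rev_ordK.
have ww : perm_mx w *m perm_mx w = 1%:M :> 'M[R]_n.+1.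
  by rewrite -{2}wV -perm_mxM mulgV perm_mx1.
have uU : U \in unitmx.
  move: (congr1 determinant PE); rewrite !det_mulmx dL mul1r => dU.
  rewrite unitmxE -dU det_perm unitrM -unitmxE uM andbT.
  by rewrite unitrX// unitrN1.
exists s^-1%g, w, L, (perm_mx w *m U *m perm_mx w); split => //.
- rewrite -!mulmxA ww mulmx1 (mulmxA _ _ U) ww mul1mx -PE mulmxA -perm_mxM.
  by rewrite mulVg perm_mx1 mul1mx.
- apply/is_trig_mxP => i j ij.
  have ij' : i != j by rewrite -val_eqE /= ltn_eqF.
  by rewrite (Ll i j (ltnW ij)) (negbTE ij').
- by rewrite unitmxE dL unitr1.
- apply/is_trig_mxP => i j ij.
  rewrite -row_permE -[in X in _ *m perm_mx X]wV -col_permE !mxE !permE.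
  apply: Uu => /=; apply: ltn_sub2l; last by rewrite ltnS.
  by rewrite ltnS (leq_trans ij)// -ltnS ltn_ord.
- by rewrite !unitmx_mul !unitmx_perm uU.
Qed.

Lemma rescales_unit (M : 'M[R]_6) : M \in unitmx -> rescales M.
Proof.
move=> /trig_decomposition[s [w [L [L' [-> tL uL tL' uL']]]]].
apply: rescales_mul; first exact: rescales_perm.
apply: rescales_mul; first exact: rescales_trig.
apply: rescales_mul; last exact: rescales_perm.
by apply: rescales_mul; [exact: rescales_perm|exact: rescales_trig].
Qed.

(** A linear change of coordinates makes the form into the last coordinate. *)
Lemma Vol_hyperplane (c : 'rV[R]_6) : c != 0 ->
  meas6 [set x | dot c x = 0] /\ Vol [set x | dot c x = 0] = 0%E.
Proof.
move=> c0; have [j cj] : exists j, c 0 j != 0.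
  apply/existsP; apply: contraNT c0; rewrite negb_exists => /forallP H.
  by apply/eqP/rowP => j; rewrite mxE; apply/eqP; have := H j; rewrite negbK.
pose o5 := @Ordinal 6 5 isT.
pose A : set 'rV[R]_6 := [set x | x 0 o5 = 0].
pose M : 'M[R]_6 := col_repl j (c 0) *m tperm_mx j o5.
have gM : rescales M.
  by apply: rescales_mul; [exact: rescales_col_repl|exact: rescales_tperm].
have AE : [set x | dot c x = 0] = [set x | A (x *m M)].
  have E x : (x *m M) 0 o5 = dot c x.
    rewrite mulmxA mul_tperm_mx tpermR mxE.
    by apply: eq_bigr => k _; rewrite mxE eqxx mulrC.
  by apply/seteqP; split => x; rewrite /A /= E.
have A0 : meas6 A /\ Vol A = 0%E.
  have AE' : row6 @^-1` A = setT `*` [set 0 : R].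
    apply/seteqP; split => -[t y]; rewrite /A /row6 /= !mxE /=.
      by move=> ->.
    by case.
  have mA : measurable (row6 @^-1` A).
    by rewrite AE'; exact: measurableX.
  split => //; rewrite VolE AE'.
  transitivity (mu5 setT * mu [set 0%R])%E; first exact: line_prodE.
  by rewrite lebesgue_measure_set1 mule0.
rewrite AE; have [mA VA] := gM _ A0.1; split => //.
by rewrite VA A0.2 mule0.
Qed.

Lemma Vol_null_bigU (I : eqType) (s : seq I) (N : I -> set 'rV[R]_6) :
  (forall i, i \in s -> meas6 (N i) /\ Vol (N i) = 0%E) ->
  meas6 (\big[setU/set0]_(i <- s) N i) /\
  Vol (\big[setU/set0]_(i <- s) N i) = 0%E.
Proof.
elim: s => [_|i s IH Ns].
  rewrite big_nil; split; first exact: measurable0.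
  by rewrite VolE preimage_set0 measure0.
have [mU VU] := IH (fun k ks => Ns k (mem_behead (ks : k \in behead (i :: s)))).
have [mN VN] := Ns i (mem_head _ _).
rewrite big_cons; split; first exact: measurableU.
by move: VU VN; rewrite !VolE preimage_setU => VU VN; rewrite measureU0.
Qed.

(** The overlap of a piece with the union of the others is a finite union of
    null sets. *)
Lemma Vol_bigU (I : eqType) (s : seq I) (A : I -> set 'rV[R]_6) :
  uniq s -> (forall i, meas6 (A i)) ->
  (forall i j, i != j ->
    exists2 c, c != 0 & A i `&` A j `<=` [set x | dot c x = 0]) ->
  meas6 (\big[setU/set0]_(i <- s) A i) /\
  Vol (\big[setU/set0]_(i <- s) A i) = (\sum_(i <- s) Vol (A i))%E.
Proof.
move=> + mA Ao; elim: s => [_|i s IH /= /andP[iNs us]].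
  rewrite !big_nil; split; first exact: measurable0.
  by rewrite VolE preimage_set0 measure0.
have [mU VU] := IH us; rewrite !big_cons -VU.
set B := \big[_/_]_(_ <- _) _.
have mI : meas6 (A i `&` B) by exact: measurableI (mA i) mU.
have N : Vol (A i `&` B) = 0%E.
  rewrite /B big_distrr; apply: (proj2 (Vol_null_bigU _ _ _ _)) => j js.
  have ij : i != j by apply/eqP => ij; move: iNs; rewrite ij js.
  have mij : meas6 (A i `&` A j) by exact: measurableI (mA i) (mA j).
  split => //; have [c c0 Ac] := Ao _ _ ij; have [mH VH] := Vol_hyperplane c c0.
  apply/eqP; rewrite eq_le !VolE measure_ge0 andbT -[leRHS]VH VolE.
  by apply: le_measure; rewrite ?inE// => u /Ac.
split; first exact: measurableU (mA i) mU.
move: N; rewrite !VolE preimage_setU preimage_setI => N.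
set a := row6 @^-1` A i in N *; set b := row6 @^-1` B in N *.
have -> : a `|` b = a `|` (b `\` a) by rewrite setUDr setDv setD0.
have mab : measurable (b `\` a) by exact: measurableD mU (mA i).
rewrite (measureU _ (mA i) mab); last by rewrite setDIK.
congr (_ + _)%E; rewrite [RHS](measureDI mu6 mU (mA i)) -/a -/b setIC.
by move: N => /= ->; rewrite adde0.
Qed.

Lemma std_simplexP (x : 'rV[R]_6) : std_simplex R x <-> corner 6 x.
Proof.
by split=> -[x0 x1]; split => //; move: x1; rewrite sum6.
Qed.

Lemma Vol_std_simplex : meas6 (std_simplex R) /\
  Vol (std_simplex R) = ((6`!%:R)^-1)%:E.
Proof.
have S2 := simplicial_step _ _ _ _ (@simplicial_line R).
have S3 := simplicial_step mu2 _ _ _ S2.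
have S4 := simplicial_step mu3 _ _ _ S3.
have S5 := simplicial_step mu4 _ _ _ S4.
have [mD ms _ /(_ _ ler01) H] := simplicial_step mu5 _ _ _ S5.
have E : row6 @^-1` std_simplex R = [set u : M6 |
    (((((`[0, +oo[%classic u.1.1.1.1.1 /\ 0 <= u.1.1.1.1.2) /\
     0 <= u.1.1.1.2) /\ 0 <= u.1.1.2) /\ 0 <= u.1.2) /\ 0 <= u.2) /\
    u.1.1.1.1.1 + u.1.1.1.1.2 + u.1.1.1.2 + u.1.1.2 + u.1.2 + u.2 <= 1].
  apply/seteqP; split => u; rewrite /std_simplex /=
    /x12 /x23 /x31 /x13 /x32 /x21 !mxE /= in_itv /= andbT.
    move=> [u0 u1]; split => //.
    have := u0 (@Ordinal 6 0 isT); have := u0 (@Ordinal 6 1 isT).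
    have := u0 (@Ordinal 6 2 isT); have := u0 (@Ordinal 6 3 isT).
    have := u0 (@Ordinal 6 4 isT); have := u0 (@Ordinal 6 5 isT).
    by rewrite !mxE.
  move=> [[[[[[a b] c] d] e] f] u1]; split => // k; rewrite mxE.
  by case: k => -[|[|[|[|[|[|//]]]]]].
split.
  rewrite /meas6 E; apply: measurableI => //.
  have := ms measurableT `]-oo, 1]%classic (measurable_itv _).
  by rewrite setTI; congr measurable; apply/seteqP;
    split => u /=; rewrite in_itv.
by rewrite VolE E; move: H; rewrite expr1n div1r.
Qed.

End R6.

(** * The vertices, cells and separating forms as integer data *)

(** The determinant by expansion along the first row, in a form that evaluates;
    [bump j] skips the column [j]. *)
Fixpoint laplace (n : nat) (f : nat -> nat -> int) : int :=
  if n is n'.+1 then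
    foldr (fun j acc => (-1) ^+ j * f 0%N j *
      laplace n' (fun r c => f r.+1 (bump j c)) + acc) 0 (iota 0 n)
  else 1.

Lemma laplaceE (R : comNzRingType) n (f : nat -> nat -> int) :
  \det (\matrix_(i < n, j < n) (f i j)%:~R : 'M[R]_n) = (laplace n f)%:~R.
Proof.
elim: n f => [|n IH] f; first by rewrite det_mx00.
rewrite (expand_det_row _ ord0).
have -> : laplace n.+1 f = \sum_(0 <= j < n.+1) (-1) ^+ j * f 0%N j *
    laplace n (fun r c => f r.+1 (bump j c)).
  by rewrite unlock /index_iota subn0 [LHS]/=; congr (_ + _);
    elim: (iota 1 n) => //= a s ->.
rewrite big_mkord rmorph_sum.
apply: eq_bigr => j _; rewrite /cofactor !mxE /= add0n !intrM.
rewrite mulrCA mulrA -IH; congr (_ * _).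
  by rewrite rmorphXn rmorphN1.
by congr (\det _); apply/matrixP => r c; rewrite !mxE.
Qed.

(** The vertices other than the origin, in the order P_31, Q_32_31, Q_23_21,
    Q_12_13, T_31_13, T_21_12, K_21_31, R_1, V_12_31, V_31_23, as numerators
    over the common denominators [vden]. *)
Definition vnum : seq (seq int) :=
  [:: [:: 0; 0; 1; 0; 0; 0]; [:: 0; 0; 1; 0; 1; 0]; [:: 0; 1; 0; 0; 0; 1];
      [:: 1; 0; 0; 1; 0; 0]; [:: 0; 0; 1; 1; 0; 0]; [:: 1; 0; 0; 0; 0; 1];
      [:: 0; 0; 1; 0; 0; 1]; [:: 1; 1; 1; 0; 0; 0]; [:: 2; 0; 1; 0; 0; 0];
      [:: 0; 1; 2; 0; 0; 0]].

Definition vden : seq nat := [:: 2; 2; 2; 2; 3; 3; 4; 3; 4; 4]%N.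

Definition cells : seq (seq nat) :=
  [:: [:: 0; 1; 2; 4; 5; 6]; [:: 0; 1; 2; 4; 5; 3]; [:: 0; 1; 2; 7; 5; 3];
      [:: 0; 1; 2; 4; 7; 3]; [:: 0; 1; 8; 7; 5; 3]; [:: 0; 1; 2; 4; 7; 9]]%N.

Definition num (k j : nat) : int := nth 0 (nth [::] vnum k) j.
Definition den (k : nat) : nat := nth 1%N vden k.
Definition cell (i a : nat) : nat := nth 0%N (nth [::] cells i) a.

(** The list [i] has one form for each [j] above [i]: an integral solution of
    the linear program that asks for a form vanishing on the common vertices of
    the cells [i] and [j], negative on the other vertices of [i] and positive on
    the other vertices of [j].  The opposite form serves the pair [j], [i]. *)
Definition separators : seq (seq (seq int)) :=
  [:: [:: [:: 1; 1; 0; 0; 0; -1]; [:: 5; 5; 0; -3; 0; -5];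
          [:: 2; 5; 0; 0; 0; -5]; [:: 5; 3; 0; -3; 0; -5];
          [:: 1; 4; 0; 0; 0; -4]];
      [:: [:: 1; 1; 0; -1; 0; -1]; [:: 0; 1; 0; 0; 0; -1];
          [:: 3; 1; 0; -3; 0; -3]; [:: -2; 5; 0; 0; 0; -5]];
      [:: [:: -1; 1; 0; 1; 0; -1]; [:: 1; -1; 0; -1; 0; -1];
          [:: -5; 5; 0; 3; 0; -5]];
      [:: [:: 3; -3; 0; -3; 0; 1]; [:: -1; 1; 0; 0; 0; -1]];
      [:: [:: -5; 5; 0; 3; 0; -3]]].

Definition separator (i j : nat) : seq int :=
  if (i < j)%N then nth [::] (nth [::] separators i) (j - i.+1)%N
  else [seq - c | c <- nth [::] (nth [::] separators j) (i - j.+1)%N].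

(** Only the sign of a form at a vertex matters, so it is evaluated at the
    numerators of the vertex. *)
Definition zdot (c : seq int) (k : nat) : int :=
  foldr (fun j acc => c`_j * num k j + acc) 0 (iota 0 6).

Definition separates (i j : nat) : bool :=
  let c := separator i j in
  let ci := nth [::] cells i in let cj := nth [::] cells j in
  [&& has (fun k => c`_k != 0) (iota 0 6),
      all (fun k => (zdot c k <= 0) && ((zdot c k == 0) ==> (k \in cj))) ci
    & all (fun k => (0 <= zdot c k) && ((zdot c k == 0) ==> (k \in ci))) cj].

Lemma separators_separate :
  all (fun i => all (fun j => (i == j) || separates i j) (iota 0 6)) (iota 0 6).
Proof. by vm_compute. Qed.

Section concrete.
Context {R : realType}.

Definition vtx (k : nat) : 'rV[R]_6 := \row_j ((num k j)%:~R / (den k)%:R).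

Definition cellmx (i : nat) : 'M[R]_6 := \matrix_a vtx (cell i a).

Lemma row_cellmx i a : row a (cellmx i) = vtx (cell i a).
Proof. exact: rowK. Qed.

Lemma vtxE :
  (vtx 0 = P_31 R) * (vtx 1 = Q_32_31 R) * (vtx 2 = Q_23_21 R) *
  (vtx 3 = Q_12_13 R) * (vtx 4 = T_31_13 R) * (vtx 5 = T_21_12 R) *
  (vtx 6 = K_21_31 R) * (vtx 7 = R_1 R) * (vtx 8 = V_12_31 R) *
  (vtx 9 = V_31_23 R).
Proof.
have E k (v : 'rV[R]_6) :
    (forall j : 'I_6, (num k j)%:~R / (den k)%:R = v 0 j) -> vtx k = v.
  by move=> H; apply/rowP => j; rewrite mxE H.
do !split; apply: E => -[[|[|[|[|[|[|//]]]]]] lt]; rewrite mxE /= /num /den /=;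
  rewrite ?mul0r ?mul1r//; by field.
Qed.

Lemma range6 T (f : 'I_6 -> T) : range f =
  [set f (@Ordinal 6 0 isT); f (@Ordinal 6 1 isT); f (@Ordinal 6 2 isT);
       f (@Ordinal 6 3 isT); f (@Ordinal 6 4 isT); f (@Ordinal 6 5 isT)].
Proof.
apply/seteqP; split => [_ [i _ <-]|x].
  have E k (l l' : (k < 6)%N) : Ordinal l = Ordinal l' by exact: val_inj.
  by case: i => -[|[|[|[|[|[|//]]]]]] lt; rewrite (E _ lt isT) /=; tauto.
by case=> [[[[[->|->]|->]|->]|->]|->]; eexists.
Qed.

Lemma DeltasE (i : 'I_6) : Deltas R i = corner_hull (cellmx i).
Proof.
rewrite corner_hullE range6 !setUA !row_cellmx.
by case: i => -[|[|[|[|[|[|//]]]]]] lt; rewrite /cell /= !vtxE.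
Qed.

Lemma dot6 (a b c d e f : R) x :
  dot (pt6 a b c d e f) x =
  a * x12 x + b * x23 x + c * x31 x + d * x13 x + e * x32 x + f * x21 x.
Proof. by rewrite /dot sum6 !mxE. Qed.

Lemma pt6P (x : 'rV[R]_6) :
  x = pt6 (x12 x) (x23 x) (x31 x) (x13 x) (x32 x) (x21 x).
Proof.
apply/rowP => -[[|[|[|[|[|[|//]]]]]] lt]; rewrite mxE /=; congr (x _ _);
  exact: val_inj.
Qed.

Lemma pt6E (a b c d e f : R) :
  (x12 (pt6 a b c d e f) = a) * (x23 (pt6 a b c d e f) = b) *
  (x31 (pt6 a b c d e f) = c) * (x13 (pt6 a b c d e f) = d) *
  (x32 (pt6 a b c d e f) = e) * (x21 (pt6 a b c d e f) = f).
Proof. by rewrite /x12 /x23 /x31 /x13 /x32 /x21 !mxE. Qed.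

Definition zrow (c : seq int) : 'rV[R]_6 := \row_j (c`_j)%:~R.

Lemma dot_zrow c k : dot (zrow c) (vtx k) = (zdot c k)%:~R / (den k)%:R.
Proof.
rewrite /dot sum6 !mxE /zdot /= !rmorphD !rmorphM rmorph0 /= addr0.
by rewrite !mulrDl !mulrA !addrA.
Qed.

Lemma separated (i j : 'I_6) : i != j -> let c := zrow (separator i j) in
  [/\ c != 0,
      forall a, dot c (row a (cellmx i)) <= 0,
      forall a, dot c (row a (cellmx i)) = 0 ->
        corner_hull (cellmx j) (row a (cellmx i)),
      forall a, 0 <= dot c (row a (cellmx j))
    & forall a, dot c (row a (cellmx j)) = 0 ->
        corner_hull (cellmx i) (row a (cellmx j))].
Proof.
move=> ij c.
have im (k : 'I_6) : (k : nat) \in iota 0 6 by rewrite mem_iota /= ltn_ord.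
have /allP/(_ _ (im i))/allP/(_ _ (im j)) := separators_separate.
rewrite (negbTE ij : (i == j :> nat) = false) => /and3P[c0 /allP ci /allP cj].
have den0 k : 0 < (den k)%:R :> R.
  rewrite ltr0n /den; case: (ltnP k 10) => [|k10]; last by rewrite nth_default.
  by move: k; do 10 (case=> //).
have cellP (h : 'I_6) (a : 'I_6) : cell h a \in nth [::] cells h.
  by apply: mem_nth; case: h => -[|[|[|[|[|[|//]]]]]] lt; case: a.
have hullP (h : 'I_6) k :
    k \in nth [::] cells h -> corner_hull (cellmx h) (vtx k).
  move=> /(nthP 0%N)[a ah <-]; have a6 : (a < 6)%N.
    by move: ah; case: h => -[|[|[|[|[|[|//]]]]]] lt.
  by have := corner_hull_row _ _ (cellmx h) (Ordinal a6); rewrite row_cellmx.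
have sgn0 k : (dot c (vtx k) == 0) = (zdot (separator i j) k == 0).
  by rewrite dot_zrow mulf_eq0 invr_eq0 (gt_eqF (den0 k)) orbF intr_eq0.
split => [|a|a|a|a]; rewrite ?row_cellmx.
- apply: contraTneq c0 => /rowP c0; apply/hasPn => k.
  rewrite mem_iota => /= k6; rewrite negbK.
  by have /eqP := c0 (Ordinal k6); rewrite !mxE /= intr_eq0.
- have /andP[ck _] := ci _ (cellP i a).
  by rewrite dot_zrow pmulr_lle0 ?invr_gt0// lerz0.
- have /andP[_ /implyP ck] := ci _ (cellP i a).
  by move=> /eqP; rewrite sgn0 => /ck; exact: hullP.
- have /andP[ck _] := cj _ (cellP j a).
  by rewrite dot_zrow pmulr_lge0 ?invr_gt0// ler0z.
- have /andP[_ /implyP ck] := cj _ (cellP j a).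
  by move=> /eqP; rewrite sgn0 => /ck; exact: hullP.
Qed.

Lemma det_cellmx (i : nat) : \det (cellmx i) =
  (\prod_(a < 6) (den (cell i a))%:R^-1) *
  (laplace 6 (fun a j => num (cell i a) j))%:~R.
Proof.
(* The matrix is diag(1 / den) times the integer matrix of the numerators. *)
pose d : 'rV[R]_6 := \row_a (den (cell i a))%:R^-1.
have -> : \prod_(a < 6) (den (cell i a))%:R^-1 = \det (diag_mx d).
  by rewrite det_diag; apply: eq_bigr => a _; rewrite mxE.
rewrite -laplaceE -det_mulmx; congr (\det _); apply/matrixP => a b.
by rewrite mul_diag_mx !mxE mulrC.
Qed.

Lemma norm_det_cellmx (i : 'I_6) : `|\det (cellmx i)| =
  nth 0 [:: 1 / 288; 1 / 144; 1 / 72; 1 / 144; 1 / 144; 1 / 288] i.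
Proof.
have den0 : 0 <= \prod_(a < 6) (den (cell i a))%:R^-1 :> R.
  by apply: prodr_ge0 => a _; rewrite invr_ge0 ler0n.
have -> : `|\det (cellmx i)| = (\prod_(a < 6) (den (cell i a))%:R^-1) *
    (nth 0%N [:: 1; 1; 2; 1; 2; 1]%N i)%:R.
  rewrite det_cellmx normrM (ger0_norm den0); congr (_ * _).
  rewrite -intr_norm -[RHS]/((_%:Z)%:~R); congr (_%:~R).
  by case: i {den0} => -[|[|[|[|[|[|//]]]]]] lt; vm_compute.
rewrite !big_ord_recl big_ord0 /den /cell.
by case: i {den0} => -[|[|[|[|[|[|//]]]]]] lt /=; field.
Qed.
End concrete.

(** * The triangulation *)

Section polytope.
Context {R : realType}.
Implicit Types x : 'rV[R]_6.

(** The forms L1, L2, L3 are [Lrow 0], [Lrow 1], [Lrow 2]. *)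
Definition Lrow (k : nat) : 'rV[R]_6 := nth 0
  [:: pt6 1 0 2 1 0 2; pt6 2 1 0 0 2 1; pt6 0 2 1 2 1 0] k.
Definition delta_row : 'rV[R]_6 := pt6 1 1 1 (-1) (-1) (-1).

(** An inequality description of [polytopeP11], as [polytopeP11E] shows. *)
Definition cone_slice : set 'rV[R]_6 :=
  [set x : 'rV[R]_6 | [/\ forall k, 0 <= x 0 k, dot (Lrow 0) x <= 1,
     dot (Lrow 1) x <= dot (Lrow 0) x, dot (Lrow 2) x <= dot (Lrow 0) x
     & 0 <= dot delta_row x]].

Lemma polytopePE x : polytopeP R x <->
  (forall k, 0 <= x 0 k) /\ (forall k, (k < 3)%N -> dot (Lrow k) x <= 1).
Proof.
split=> [[x0 h1 h2 h3]|[x0 h]].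
  by split => // -[|[|[|//]]] _; rewrite /Lrow /= dot6; lra.
have := h 0%N isT; have := h 1%N isT; have := h 2%N isT.
by rewrite /Lrow /= !dot6 => *; split => //; lra.
Qed.

Lemma nonneg6 x : (forall k, 0 <= x 0 k) ->
  [/\ 0 <= x12 x, 0 <= x23 x, 0 <= x31 x
    & [/\ 0 <= x13 x, 0 <= x32 x & 0 <= x21 x]].
Proof. by move=> x0; split; [exact: x0..|split; exact: x0]. Qed.

Lemma pt6_ge0 (a b c d e f : R) : 0 <= a -> 0 <= b -> 0 <= c -> 0 <= d ->
  0 <= e -> 0 <= f -> forall k, 0 <= pt6 a b c d e f 0 k.
Proof. by move=> ? ? ? ? ? ? -[[|[|[|[|[|[|//]]]]]] lt]; rewrite mxE. Qed.

(** The product of [x] with the inverse of the matrix of the cell [i], in terms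
    of the coordinates of [x]. *)
Definition barycentric (i : nat) x : 'rV[R]_6 :=
  let: (a, b, c, d, e, f) := (x12 x, x23 x, x31 x, x13 x, x32 x, x21 x) in
  nth 0 [:: pt6 (2 * (a + b + c - d - e - f)) (2 * e) (2 * b)
              (3 * d) (3 * a) (4 * (f - a - b));
            pt6 (2 * (a + b + c - d - e - f)) (2 * e) (2 * b)
              (3 * (d + f - a - b)) (3 * (f - b)) (2 * (a + b - f));
            pt6 (2 * c - a - b + d - 2 * e + f) (2 * e) (b - a + d + f)
              (3 / 2 * (a + b - d - f)) (3 / 2 * (a - b - d + f)) (2 * d);
            pt6 (2 * (a - 2 * b + c - d - e + 2 * f)) (2 * e) (2 * f)
              (3 * (b + d - a - f)) (3 * (b - f)) (2 * (a + f - b));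
            pt6 (2 * c - a - b + d - 2 * e + f) (2 * e) (2 * (a - b - d - f))
              (3 * b) (3 * f) (2 * d);
            pt6 (2 * (a - 2 * b + c - d - e + 2 * f)) (2 * e) (2 * f)
              (3 * d) (3 * a) (4 * (b - a - f))] i.

Lemma barycentricK (i : 'I_6) x : barycentric i x *m cellmx i = x.
Proof.
rewrite [RHS]pt6P /barycentric.
move: (x12 x) (x23 x) (x31 x) (x13 x) (x32 x) (x21 x) => a b c d e f.
apply/rowP => -[k lt]; rewrite mxE sum6 [RHS]mxE.
case: i => -[|[|[|[|[|[|//]]]]]] ilt; rewrite !mxE /= /num /den /cell /=;
  move: k lt => -[|[|[|[|[|[|//]]]]]] lt /=; by field.
Qed.

(** Both sides are linear in [x] and take the value 1 at the six vertices. *)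
Lemma sum_barycentric (i : 'I_6) x :
  \sum_k barycentric i x 0 k = dot (Lrow 0) x.
Proof.
rewrite sum6 /Lrow dot6 /barycentric.
by case: i => -[|[|[|[|[|[|//]]]]]] ilt; rewrite !mxE /=; field.
Qed.

(** Let a, b, c, d, e, f be the coordinates of the point in their order.  Among
    the points of [cone_slice], each of the cells 5, 4 and 0 is cut out by the
    single inequality b >= a + f, a >= b + d + f, f >= a + b: its other
    barycentric coordinates are nonnegative throughout.  Outside these three,
    the cells 1, 2, 3 are told apart by the signs of d + f - a - b,
    b + d - a - f and f - b. *)
Lemma cone_slice_cover x : cone_slice x ->
  exists i : 'I_6, corner_hull (cellmx i) x.
Proof.
move=> [x0 h1 h2 h3 h4].
suff [i b0] : exists i : 'I_6, forall k, 0 <= barycentric i x 0 k.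
  exists i, (barycentric i x); last exact: barycentricK.
  by split => //; rewrite sum_barycentric.
move: h2 h3 h4; rewrite /delta_row !dot6 /barycentric {h1}.
have := nonneg6 _ x0.
move: {x0} (x12 x) (x23 x) (x31 x) (x13 x) (x32 x) (x21 x).
move=> a b c d e f [a0 b0 c0 [d0 e0 f0]] h2 h3 h4.
have [h|h6] := lerP (a + f) b.
  by exists (@Ordinal 6 5 isT); apply: pt6_ge0; lra.
have [h|h5] := lerP (d + f + b) a.
  by exists (@Ordinal 6 4 isT); apply: pt6_ge0; lra.
have [h|h1] := lerP (a + b) f.
  by exists (@Ordinal 6 0 isT); apply: pt6_ge0; lra.
have [hT|hT] := lerP (a + b) (d + f).
  have [h|h] := lerP b f.
    by exists (@Ordinal 6 1 isT); apply: pt6_ge0; lra.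
  by exists (@Ordinal 6 3 isT); apply: pt6_ge0; lra.
have [h|h] := lerP (a + f) (b + d).
  by exists (@Ordinal 6 3 isT); apply: pt6_ge0; lra.
by exists (@Ordinal 6 2 isT); apply: pt6_ge0; lra.
Qed.

(** The conditions hold at the origin and on the facet, and define a convex
    set. *)
Lemma polytopeP1_sub x : polytopeP1 x ->
  [/\ forall k, 0 <= x 0 k, dot (Lrow 0) x <= 1,
     dot (Lrow 1) x <= dot (Lrow 0) x & dot (Lrow 2) x <= dot (Lrow 0) x].
Proof.
move: x; apply: conv_sub.
  apply/convexP => x y t [x0 x1 x2 x3] [y0 y1 y2 y3] t0 t1.
  have t1' : 0 <= 1 - t by rewrite subr_ge0 ltW.
  rewrite /= !dotD !dotZ; split.
  - by move=> k; rewrite !mxE addr_ge0// mulr_ge0// ltW.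
  - apply: (@le_trans _ _ (t * 1 + (1 - t) * 1)).
      by apply: lerD; apply: ler_wpM2l => //; exact: ltW.
    by rewrite -mulrDl subrKC mul1r.
  - by apply: lerD; apply: ler_wpM2l => //; exact: ltW.
  - by apply: lerD; apply: ler_wpM2l => //; exact: ltW.
move=> x [->|[[x0 h1 h2 h3] h]].
  have d0 c : dot c (0 : 'rV[R]_6) = 0.
    by rewrite /dot big1// => k _; rewrite mxE mulr0.
  by split; rewrite ?d0 ?ler01// => k; rewrite mxE.
by rewrite /= /Lrow /= !dot6; split => //; lra.
Qed.

Lemma polytopeP11_cone_slice : polytopeP11 R `<=` cone_slice.
Proof.
move=> x [/polytopeP1_sub[x0 h1 h2 h3] h]; split => //.
by rewrite /delta_row dot6; lra.
Qed.

Lemma polytopeP11_convex : convex_set (polytopeP11 R).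
Proof.
have E z : (x13 z + x32 z + x21 z <= x12 z + x23 z + x31 z) =
    (0 <= dot delta_row z) :> bool.
  by rewrite /delta_row dot6; apply/idP/idP; lra.
apply/convexP => x y t [Px x1] [Py y1] t0 t1; split.
  by move/convexP : (@conv_convex R 6 ([set 0] `|` @facetF1 R)); apply.
rewrite E in x1; rewrite E in y1; rewrite E dotD !dotZ.
by rewrite addr_ge0// mulr_ge0// ?subr_ge0 ltW.
Qed.

Lemma pt6_polytopeP11 (a b c d e f : R) :
  0 <= a -> 0 <= b -> 0 <= c -> 0 <= d -> 0 <= e -> 0 <= f ->
  a + d + 2 * (f + c) = 1 -> f + b + 2 * (a + e) <= 1 ->
  c + e + 2 * (d + b) <= 1 -> d + e + f <= a + b + c ->
  polytopeP11 R (pt6 a b c d e f).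
Proof.
move=> a0 b0 c0 d0 e0 f0 h1 h2 h3 h4.
split; last by rewrite /x12 /x23 /x31 /x13 /x32 /x21 !mxE.
apply: sub_conv; right.
rewrite /facetF1 /polytopeP /x12 /x23 /x31 /x13 /x32 /x21 /= !mxE /=.
by split => //; split => //; [exact: pt6_ge0|rewrite h1].
Qed.

Lemma vtx_polytopeP11 k : (k < 10)%N -> polytopeP11 R (vtx k).
Proof.
do 10 (case: k => [_|k];
  first by rewrite vtxE; apply: pt6_polytopeP11; (exact: lexx || lra)).
by [].
Qed.

Lemma cell_sub_polytopeP11 (i : 'I_6) :
  corner_hull (cellmx i) `<=` polytopeP11 R.
Proof.
move=> _ [y Cy <-]; apply: convex_corner_mem => //.
- exact: polytopeP11_convex.
- split; first by apply: sub_conv; left.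
  by rewrite /x12 /x23 /x31 /x13 /x32 /x21 !mxE !addr0.
- move=> a _; rewrite row_cellmx; apply: vtx_polytopeP11.
  by case: i => -[|[|[|[|[|[|//]]]]]] lt; case: a => -[|[|[|[|[|[|//]]]]]] lt'.
Qed.

Lemma polytopeP11_cells :
  polytopeP11 R = \bigcup_(i : 'I_6) corner_hull (cellmx i).
Proof.
apply/seteqP; split => x.
  by move=> /polytopeP11_cone_slice/cone_slice_cover[i xi]; exists i.
by move=> [i _]; exact: cell_sub_polytopeP11.
Qed.

Lemma polytopeP11E : polytopeP11 R = cone_slice.
Proof.
apply/seteqP; split; first exact: polytopeP11_cone_slice.
by move=> x /cone_slice_cover[i]; exact: cell_sub_polytopeP11.
Qed.

Lemma unit_cellmx (i : 'I_6) : cellmx i \in (unitmx : {pred 'M[R]_6}).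
Proof.
rewrite unitmxE unitfE -normr_eq0 norm_det_cellmx.
by case: i => -[|[|[|[|[|[|//]]]]]] lt /=; rewrite mul1r invr_eq0 pnatr_eq0.
Qed.

Lemma dot_cellP (c : 'rV[R]_6) (i : nat) :
  (forall a, 0 <= dot c (row a (cellmx i))) ->
  forall x, corner_hull (cellmx i) x -> 0 <= dot c x.
Proof.
move=> c0 _ [y [y0 _] <-]; rewrite dot_mul; apply: sumr_ge0 => a _.
exact: mulr_ge0.
Qed.

Lemma triangulates_polytopeP11 : triangulates (Deltas R) (polytopeP11 R).
Proof.
split=> [i||i j _].
- by rewrite DeltasE; exact/corner_hull_simplex/unit_cellmx.
- by rewrite polytopeP11_cells; apply: eq_bigcupr => i _; rewrite DeltasE.
have triv (A : set 'rV[R]_6) : is_face A A.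
  exists 0, 0; have d0 x : \sum_k (0 : 'rV[R]_6) 0 k * x 0 k = 0.
    by rewrite big1// => k _; rewrite mxE mul0r.
  split=> [x _|]; first by rewrite d0.
  by apply/seteqP; split => [x Ax|x []//]; split.
have [->|ij] := eqVneq i j; first by rewrite setIid.
rewrite !DeltasE; have /= := @separated R _ _ ij.
set c := zrow _ => -[_ ci ci0 cj cj0].
split; [|rewrite setIC];
  [apply: (separated_face _ _ c)|apply: (separated_face _ _ (- c))] => //;
  try exact: corner_hull_convex; try exact: corner_hull0.
- exact: dot_cellP.
- by move=> x; apply: dot_cellP => a; rewrite dotNl oppr_ge0.
- by move=> a; rewrite dotNl oppr_le0.
- by move=> a; rewrite dotNl => /eqP; rewrite oppr_eq0 => /eqP; exact: cj0.
Qed.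

End polytope.

(** * The volume *)

Section volume.
Context {R : realType}.
Implicit Types x : 'rV[R]_6.

Lemma Vol_corner_hull (W : 'M[R]_6) : W \in unitmx ->
  meas6 (corner_hull W) /\ Vol (corner_hull W) = (`|\det W| / 6`!%:R)%:E.
Proof.
move=> uW; have uV : invmx W \in unitmx by rewrite unitmx_inv.
have [mD VD] := @Vol_std_simplex R.
have -> : corner_hull W = [set x | std_simplex R (x *m invmx W)].
  apply/seteqP; split => [_ [y /std_simplexP Dy <-]|x /std_simplexP Dx] /=.
    by rewrite mulmxK.
  by exists (x *m invmx W) => //; rewrite mulmxKV.
have [mS VS] := rescales_unit _ uV _ mD; split => //.
by rewrite VS VD det_inv normfV invrK -EFinM.
Qed.

Lemma Vol_polytopeP11 : meas6 (polytopeP11 R) /\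
  Vol (polytopeP11 R) = (1 / 24 / 6`!%:R)%:E.
Proof.
have -> : polytopeP11 R = \big[setU/set0]_(i < 6) corner_hull (cellmx i).
  rewrite polytopeP11_cells -bigcup_seq.
  by apply/seteqP; split => x [i _ xi]; exists i => //=; rewrite mem_index_enum.
have [|i|i j ij|mU VU] := @Vol_bigU R _ (index_enum 'I_6)
  (fun i : 'I_6 => corner_hull (cellmx i)).
- exact: index_enum_uniq.
- by have [] := Vol_corner_hull _ (unit_cellmx i).
- have /= := @separated R _ _ ij; set c := zrow _ => -[c0 ci _ cj _].
  exists c => // x [xi xj]; apply/eqP; rewrite eq_le (dot_cellP c j)// andbT.
  rewrite -oppr_ge0 -dotNl; apply: (dot_cellP (- c) i) => // a.
  by rewrite dotNl oppr_ge0.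
split => //; rewrite [LHS]VU.
under eq_bigr => i _.
  rewrite (Vol_corner_hull _ (unit_cellmx i)).2 norm_det_cellmx.
  over.
rewrite sumEFin sum6 /=; congr EFin; field.
by rewrite pnatr_eq0 -lt0n fact_gt0.
Qed.

(** A permutation p of the indices 1, 2, 3 moves x_(p i, p j) to the place of
    x_ij.  The list has the three even permutations before the three odd ones,
    and those with p 1 = 1, 2, 3 in this order in each half; its entry [g] maps
    places to places, so that coordinate [b] of [x *m permmx g] is the
    coordinate of [x] at the place to which [b] is mapped. *)
Definition perms : seq (seq nat) :=
  [:: [:: 0; 1; 2; 3; 4; 5]; [:: 1; 2; 0; 5; 3; 4]; [:: 2; 0; 1; 4; 5; 3];
      [:: 3; 4; 5; 0; 1; 2]; [:: 5; 3; 4; 1; 2; 0]; [:: 4; 5; 3; 2; 0; 1]]%N.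

Definition perm_entry (g a b : nat) : int :=
  (a == nth 0%N (nth [::] perms g) b)%:R.

Definition permmx (g : nat) : 'M[R]_6 := \matrix_(a, b) (perm_entry g a b)%:~R.

Lemma norm_det_permmx (g : 'I_6) : `|\det (permmx g)| = 1.
Proof.
rewrite laplaceE -intr_norm -[RHS]/(1%:~R); congr (_%:~R).
by case: g => -[|[|[|[|[|[|//]]]]]] lt; vm_compute.
Qed.

Lemma unit_permmx (g : 'I_6) : permmx g \in unitmx.
Proof. by rewrite unitmxE unitfE -normr_eq0 norm_det_permmx oner_eq0. Qed.

Lemma mul_permmx (g : 'I_6) x : x *m permmx g =
  nth 0 [:: pt6 (x12 x) (x23 x) (x31 x) (x13 x) (x32 x) (x21 x);
            pt6 (x23 x) (x31 x) (x12 x) (x21 x) (x13 x) (x32 x);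
            pt6 (x31 x) (x12 x) (x23 x) (x32 x) (x21 x) (x13 x);
            pt6 (x13 x) (x32 x) (x21 x) (x12 x) (x23 x) (x31 x);
            pt6 (x21 x) (x13 x) (x32 x) (x23 x) (x31 x) (x12 x);
            pt6 (x32 x) (x21 x) (x13 x) (x31 x) (x12 x) (x23 x)] g.
Proof.
apply/rowP => -[k lt]; rewrite mxE sum6 !mxE /perm_entry.
case: g => -[|[|[|[|[|[|//]]]]]] glt; rewrite mxE /=;
  move: k lt => -[|[|[|[|[|[|//]]]]]] lt /=;
  by rewrite ?(mulr0, mulr1, add0r, addr0).
Qed.

(** The same six permutations p themselves, with indices counted from 0: on the
    permuted point the form L_i takes the value of L_(p i). *)
Definition form_perms : seq (seq nat) :=
  [:: [:: 0; 1; 2]; [:: 1; 2; 0]; [:: 2; 0; 1];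
      [:: 0; 2; 1]; [:: 1; 0; 2]; [:: 2; 1; 0]]%N.

Lemma dot_Lrow_permmx (g : 'I_6) k x : (k < 3)%N ->
  dot (Lrow k) (x *m permmx g) =
  dot (Lrow (nth 0%N (nth [::] form_perms g) k)) x.
Proof.
case: k => [|[|[|//]]] _; rewrite mul_permmx /Lrow;
  case: g => -[|[|[|[|[|[|//]]]]]] glt; rewrite /= !dot6 !pt6E; ring.
Qed.

Lemma dot_delta_permmx (g : 'I_6) x :
  dot delta_row (x *m permmx g) = (-1) ^+ (2 < g)%N * dot delta_row x.
Proof.
rewrite mul_permmx /delta_row;
  case: g => -[|[|[|[|[|[|//]]]]]] glt; rewrite /= !dot6 !pt6E; ring.
Qed.

Lemma nonneg_permmx (g : 'I_6) x :
  (forall k, 0 <= (x *m permmx g) 0 k) <-> (forall k, 0 <= x 0 k).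
Proof.
rewrite mul_permmx; split.
  rewrite [in X in _ -> X](pt6P x).
  by case: g => -[|[|[|[|[|[|//]]]]]] glt /nonneg6; rewrite /= !pt6E;
    move=> [? ? ? [? ? ?]]; exact: pt6_ge0.
move=> /nonneg6[? ? ? [? ? ?]].
by case: g => -[|[|[|[|[|[|//]]]]]] glt; exact: pt6_ge0.
Qed.

(** The permutation [g] turns L1 into [Lrow (g %% 3)], by the order of the list,
    and preserves or exchanges the sides of the hyperplane with its parity. *)
Lemma cone_slice_permmx (g : 'I_6) x : cone_slice (x *m permmx g) <->
  [/\ forall k, 0 <= x 0 k, dot (Lrow (g %% 3)) x <= 1,
      forall k, (k < 3)%N -> dot (Lrow k) x <= dot (Lrow (g %% 3)) x
    & 0 <= (-1) ^+ (2 < g)%N * dot delta_row x].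
Proof.
rewrite /cone_slice /= !dot_Lrow_permmx// dot_delta_permmx.
have -> : (forall k, (k < 3)%N -> dot (Lrow k) x <= dot (Lrow (g %% 3)) x) =
    [/\ dot (Lrow 0) x <= dot (Lrow (g %% 3)) x,
        dot (Lrow 1) x <= dot (Lrow (g %% 3)) x
      & dot (Lrow 2) x <= dot (Lrow (g %% 3)) x].
  by apply/propext; split=> [H|[? ? ?] [|[|[|//]]]]//; split; exact: H.
have := nonneg_permmx g x.
case: g => -[|[|[|[|[|[|//]]]]]] glt /= gP;
  split=> [[/gP h1 h2 h3 h4 h5]|[/gP h1 h2 [h3 h4 h6] h5]]; split => //;
  by split.
Qed.

Lemma polytopeP_pieces : polytopeP R =
  \big[setU/set0]_(g < 6) [set x | polytopeP11 R (x *m permmx g)].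
Proof.
rewrite -bigcup_seq polytopeP11E; apply/seteqP; split=> x; last first.
  move=> [g _ /cone_slice_permmx[x0 h1 h _]]; apply/polytopePE.
  split => // k k3.
  exact: le_trans (h _ k3) h1.
move=> /polytopePE[x0 h].
have [k k3 kmax] : exists2 k, (k < 3)%N & forall j, (j < 3)%N ->
    dot (Lrow j) x <= dot (Lrow k) x.
  have [h01|h01] := lerP (dot (Lrow 0) x) (dot (Lrow 1) x);
    have [h12|h12] := lerP (dot (Lrow 1) x) (dot (Lrow 2) x);
    have [h02|h02] := lerP (dot (Lrow 0) x) (dot (Lrow 2) x);
    ((exists 0%N => //; case=> [|[|[|//]]] _; lra) ||
     (exists 1%N => //; case=> [|[|[|//]]] _; lra) ||
     (exists 2%N => //; case=> [|[|[|//]]] _; lra)).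
have [d0|d0] := lerP 0 (dot delta_row x).
  have g6 : (k < 6)%N by exact: ltn_trans k3 _.
  exists (Ordinal g6); first by rewrite /= mem_index_enum.
  apply/cone_slice_permmx; rewrite /= modn_small// (ltnNge 2) -ltnS k3 mul1r.
  by split => //; exact: h.
have g6 : (k + 3 < 6)%N by rewrite -[6%N]/(3 + 3)%N ltn_add2r.
exists (Ordinal g6); first by rewrite /= mem_index_enum.
apply/cone_slice_permmx; rewrite /= modnDr modn_small// addn3 /= mulN1r.
rewrite oppr_ge0.
by split => //; [exact: h|exact: ltW].
Qed.

(** Two permutations of equal parity give pieces that meet where two of the
    forms agree; otherwise the pieces meet in the balance hyperplane. *)
Lemma pieces_overlap (g h : 'I_6) : g != h ->
  exists2 c : 'rV[R]_6, c != 0 &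
    [set x | polytopeP11 R (x *m permmx g)] `&`
      [set x | polytopeP11 R (x *m permmx h)] `<=` [set x | dot c x = 0].
Proof.
move=> gh; rewrite polytopeP11E.
have [e|ne] := eqVneq (2 < g)%N (2 < h)%N.
  exists (Lrow (g %% 3) - Lrow (h %% 3)).
    apply/eqP => /rowP/(_ (@Ordinal 6 0 isT)); rewrite !mxE /Lrow; move: gh e.
    (* The first coefficients 1, 2, 0 of the three forms are distinct. *)
    case: g => -[|[|[|[|[|[|//]]]]]] glt;
      case: h => -[|[|[|[|[|[|//]]]]]] hlt //= _ _; rewrite !mxE /=; lra.
  move=> x [/cone_slice_permmx[_ _ xg _] /cone_slice_permmx[_ _ xh _]] /=.
  rewrite dotDl dotNl; apply/eqP; rewrite subr_eq0 eq_le.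
  by rewrite xh ?ltn_mod// xg ?ltn_mod.
exists delta_row.
  apply/eqP => /rowP/(_ (@Ordinal 6 0 isT)); rewrite !mxE /=.
  by apply/eqP; exact: oner_neq0.
move=> x [/cone_slice_permmx[_ _ _ xg] /cone_slice_permmx[_ _ _ xh]] /=.
move: ne xg xh; case: (2 < g)%N; case: (2 < h)%N => //= _;
  by rewrite !expr1 ?expr0; lra.
Qed.

Lemma Vol_polytopeP : Vol (polytopeP R) = (1 / 4 * (1 / 6`!%:R))%:E.
Proof.
have [mP VP] := Vol_polytopeP11.
have mV (g : 'I_6) : meas6 [set x | polytopeP11 R (x *m permmx g)] /\
    Vol [set x | polytopeP11 R (x *m permmx g)] = (1 / 24 / 6`!%:R)%:E.
  have [mg ->] := rescales_unit _ (unit_permmx g) _ mP; split => //.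
  by rewrite VP norm_det_permmx invr1 mul1e.
rewrite polytopeP_pieces.
have mA g := (mV g).1.
rewrite (Vol_bigU _ _ _ (index_enum_uniq _) mA pieces_overlap).2.
under eq_bigr => g _ do rewrite (mV g).2.
rewrite sumEFin sum6 /=; congr EFin; field.
by rewrite pnatr_eq0 -lt0n fact_gt0.
Qed.

End volume.

Theorem theorem2 (R : realType) :
  triangulates (Deltas R) (polytopeP11 R) /\
  (Vol (polytopeP R) = ((1 / 4) * (1 / (6`!)%:R))%:E /\
   Vol (polytopeP R) = ((1 / 4)%:E * Vol (std_simplex R))%E).
Proof.
split; first exact: triangulates_polytopeP11.
split; first exact: Vol_polytopeP.
by rewrite Vol_polytopeP Vol_std_simplex.2 -EFinM !div1r.
Qed.
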